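(* Let $n\ge 2$ and let $H\subset\mathbb{P}(\bigwedge^2\mathbb{C}^{2n})$ be a general hyperplane. The automorphism group of $\mathbb{G}(1,2n-1)\cap H$ is $\mathrm{Sp}(2n,\mathbb{C})/\{1,-1\}$. Its action on $\mathbb{G}(1,2n-1)\cap H$ is homogeneous (i.e. transitive).
   Context: Everything is over $\mathbb{C}$. $\mathbb{G}(1,N)$ is the Grassmannian of lines in $\mathbb{P}_N=\mathbb{P}(\mathbb{C}^{N+1})$, embedded in $\mathbb{P}(\bigwedge^2\mathbb{C}^{N+1})$ by the Plücker embedding $\mathrm{span}\{v,w\}\mapsto\mathbb{P}(v\wedge w)$. A hyperplane $H$ is given by a nonzero element of $(\bigwedge^2\mathbb{C}^{2n})^*$, identified with an antisymmetric matrix $A$ of size $2n$ (up to scalar), such that the line $p\wedge q$ lies in $H$ iff ${}^tpAq=0$; $H$ is called general if $A$ has full rank $2n$. $\mathrm{Sp}(2n,\mathbb{C})$ is the group of $T\in\mathrm{GL}(2n,\mathbb{C})$ preserving a nondegenerate antisymmetric form. *)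

(* Defs.v *)
From HB Require Import structures.
From mathcomp Require Import all_boot all_order all_algebra.
From mathcomp Require Import boolp classical_sets reals complex mpoly.

Set Implicit Arguments.
Unset Strict Implicit.
Unset Printing Implicit Defensive.

Import GRing.Theory.
Local Open Scope classical_set_scope.
Local Open Scope ring_scope.
Local Open Scope quotient_scope.

(* Points of P(F^k) are the lines through the origin of F^k. *)
Definition proj (F : closedFieldType) (k : nat) :=
  {L : {vspace 'cV[F]_k} | \dim L == 1%N}.

HB.instance Definition _ (F : closedFieldType) (k : nat) :=
  Choice.on (proj F k).

Section ProjectiveVarieties.
Variable F : closedFieldType.
Implicit Types k l m : nat.

(* x is a vector of homogeneous coordinates of P; in particular x != 0. *)
Definition coords k (P : proj F k) (x : 'cV[F]_k) : Prop := val P = <[x]>%VS.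

Definition evalv k (p : {mpoly F[k]}) (x : 'cV[F]_k) : F :=
  p.@[fun i => x i 0].

(* Zariski open: a union of sets { p != 0 } with p homogeneous. *)
Definition zariski_open k (U : set (proj F k)) : Prop :=
  exists2 S : set {mpoly F[k]}, (forall p, S p -> exists d, p \is d.-homog) &
    forall P, U P <-> exists p x, [/\ S p, coords P x & evalv p x != 0].

(* f is locally given by homogeneous polynomials of the same degree. Since the
   coordinates of a point are nonzero, the G i are required to have no common
   zero on X `&` U. *)
Definition regular k l (X : set (proj F k)) (Y : set (proj F l))
    (f : X -> Y) : Prop :=
  forall P : X, exists (U : set (proj F k)) (d : nat) (G : 'I_l -> {mpoly F[k]}),
    [/\ zariski_open U, U (val P), (forall i, G i \is d.-homog) &
        forall (Q : X) (x : 'cV[F]_k), U (val Q) -> coords (val Q) x ->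
          coords (val (f Q)) (\col_i evalv (G i) x)].

Definition automorphism k (X : set (proj F k)) (f : X -> X) : Prop :=
  regular f /\ exists g : X -> X, [/\ regular g, cancel f g & cancel g f].

Definition Aut k (X : set (proj F k)) := {f : X -> X | `[< automorphism f >]}.

HB.instance Definition _ k (X : set (proj F k)) := Choice.on (Aut X).

Lemma coords_ne0 k (P : proj F k) x : coords P x -> x != 0.
Proof.
move=> Px; have := valP P; rewrite Px /= dim_vline.
by case: (x != 0).
Qed.

Lemma coords_scale k (P : proj F k) x y :
  coords P x -> coords P y -> exists2 c, c != 0 & y = c *: x.
Proof.
move=> Px Py; have : y \in val P by rewrite Py memv_line.
rewrite Px => /vlineP[c yE]; exists c => //.
by apply: contraNneq (coords_ne0 Py) => c0; rewrite yE c0 scale0r.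
Qed.

Lemma evalvM k (p q : {mpoly F[k]}) x : evalv (p * q) x = evalv p x * evalv q x.
Proof. exact: mevalM. Qed.

Lemma evalvZ k (p : {mpoly F[k]}) d (c : F) x :
  p \is d.-homog -> evalv p (c *: x) = c ^+ d * evalv p x.
Proof.
move=> /dhomogP p_hom; rewrite /evalv !mevalE mulr_sumr !big_seq.
apply: eq_bigr => m /p_hom /= <-.
rewrite mulrCA; congr (_ * _).
under eq_bigr do rewrite mxE exprMn.
by rewrite big_split /= mdegE prodrXr.
Qed.

Lemma dhomog_comp k l (G : 'I_l -> {mpoly F[k]}) d e (p : {mpoly F[l]}) :
  (forall i, G i \is d.-homog) -> p \is e.-homog ->
  p \mPo [tuple G i | i < l] \is (d * e)%N.-homog.
Proof.
move=> G_hom /dhomogP p_hom; rewrite comp_mpolyE big_seq.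
apply: rpred_sum => m /p_hom /= <-; apply: rpredZ.
rewrite mdegE big_distrr /=.
elim/big_rec2: _ => [|i a b _ IH]; first exact: dhomog1.
by apply: dhomogM => //; rewrite tnth_mktuple; exact: dhomogMn.
Qed.

Lemma evalv_comp k l (G : 'I_l -> {mpoly F[k]}) (p : {mpoly F[l]}) x :
  evalv (p \mPo [tuple G i | i < l]) x = evalv p (\col_i evalv (G i) x).
Proof.
rewrite /evalv comp_mpoly_meval; apply: meval_eq => i.
by rewrite tnth_map tnth_ord_tuple mxE.
Qed.

Lemma regular_id k (X : set (proj F k)) : regular (@id X).
Proof.
move=> P; exists setT, 1%N, (fun i => 'X_i); split => //.
- exists [set 1] => [_ ->|Q]; first by exists 0%N; exact: dhomog1.
  split=> // _.
  have [x Qx] : exists x, coords Q x.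
    have /eqP Q1 := valP Q; exists (vpick (val Q)).
    apply/esym/eqP; rewrite eqEdim -memvE memv_pick /= Q1 dim_vline vpick0.
    by rewrite -dimv_eq0 Q1.
  by exists 1, x; split=> //; rewrite /evalv meval1 oner_neq0.
- by move=> i; rewrite dhomogX /= mdeg1.
- move=> Q x _ Qx; suff -> : \col_i evalv 'X_i x = x by [].
  by apply/colP => i; rewrite mxE /evalv mevalXU.
Qed.

Lemma regular_comp j k l (X : set (proj F j)) (Y : set (proj F k))
    (Z : set (proj F l)) (f : Y -> Z) (g : X -> Y) :
  regular f -> regular g -> regular (f \o g).
Proof.
move=> f_reg g_reg P.
have [U [d [G [[S S_hom US] UP G_hom gE]]]] := g_reg P.
have [V [e [H [[T T_hom VT] VgP H_hom fE]]]] := f_reg (g P).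
pose W := [set r : {mpoly F[j]} | exists s t, [/\ S s, T t &
             r = s * (t \mPo [tuple G i | i < k])]].
pose N := [set Q : proj F j | exists p x, [/\ W p, coords Q x & evalv p x != 0]].
exists N, (d * e)%N, (fun i => H i \mPo [tuple G i | i < k]); split.
- exists W => // _ [s [t [/S_hom[a s_hom] /T_hom[b t_hom] ->]]].
  by exists (a + d * b)%N; apply: dhomogM; last exact: dhomog_comp.
- have [s [x [Ss Px sx]]] := (US _).1 UP.
  have [t [y [Tt gPy ty]]] := (VT _).1 VgP.
  exists (s * (t \mPo [tuple G i | i < k])), x; split=> //; first by exists s, t.
  rewrite evalvM mulf_neq0 // evalv_comp.
  have [c _ yE] := coords_scale (gE P x UP Px) gPy.
  have [b t_hom] := T_hom _ Tt.
  move: ty; rewrite yE (evalvZ _ _ t_hom).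
  by apply: contraNneq => ->; rewrite mulr0.
- by move=> i; exact: dhomog_comp.
- move=> Q x [_ [y [[s [t [Ss Tt ->]]] Qy]]].
  rewrite evalvM mulf_eq0 negb_or evalv_comp => /andP[sy ty] Qx.
  have UQ : U (val Q) by apply/US; exists s, y.
  have VgQ : V (val (g Q)).
    by apply/VT; exists t, (\col_i evalv (G i) y); split=> //; exact: gE.
  have := fE _ _ VgQ (gE _ _ UQ Qx).
  by congr coords; apply/colP => i; rewrite !mxE evalv_comp.
Qed.

End ProjectiveVarieties.

Section AutomorphismGroup.
Variables (F : closedFieldType) (k : nat) (X : set (proj F k)).
Implicit Types f g : Aut X.

Lemma aut_id_subproof : `[< automorphism (@id X) >].
Proof. by apply/asboolP; split; [|exists id; split=> //]; exact: regular_id. Qed.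

Lemma aut_comp_subproof f g : `[< automorphism (val f \o val g) >].
Proof.
have /asboolP[f_reg [f' [f'_reg fK f'K]]] := valP f.
have /asboolP[g_reg [g' [g'_reg gK g'K]]] := valP g.
apply/asboolP; split; first exact: regular_comp.
by exists (g' \o f'); split; [exact: regular_comp|exact: can_comp..].
Qed.

Lemma aut_inv_subproof f :
  exists g : Aut X, cancel (val f) (val g) /\ cancel (val g) (val f).
Proof.
have /asboolP[f_reg [g [g_reg fK gK]]] := valP f.
have g_aut : `[< automorphism g >] by apply/asboolP; split=> //; exists (val f).
by exists (exist _ g g_aut).
Qed.

Definition aut_one : Aut X := exist _ id aut_id_subproof.
Definition aut_mul f g : Aut X := exist _ (val f \o val g) (aut_comp_subproof f g).
Definition aut_inv f : Aut X := projT1 (cid (aut_inv_subproof f)).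

Lemma aut_mulA : associative aut_mul.
Proof. by move=> f g h; exact: val_inj. Qed.
Lemma aut_mul1 : left_id aut_one aut_mul.
Proof. by move=> f; exact: val_inj. Qed.
Lemma aut_mulr1 : right_id aut_one aut_mul.
Proof. by move=> f; exact: val_inj. Qed.
Lemma aut_mulV : left_inverse aut_one aut_inv aut_mul.
Proof.
move=> f; apply: val_inj; apply: funext => P /=.
by rewrite /aut_inv; case: cid => g [/= fK _]; exact: fK.
Qed.
Lemma aut_mulrV : right_inverse aut_one aut_inv aut_mul.
Proof.
move=> f; apply: val_inj; apply: funext => P /=.
by rewrite /aut_inv; case: cid => g [/= _ gK]; exact: gK.
Qed.

HB.instance Definition _ := isGroup.Build (Aut X)
  aut_mulA aut_mul1 aut_mulr1 aut_mulV aut_mulrV.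

End AutomorphismGroup.

Section LineGrassmannian.
Variables (F : closedFieldType) (m : nat).

(* Indices of the basis e_i /\ e_j, i < j, of the exterior square of F^m. *)
Definition pairs := {p : 'I_m * 'I_m | (p.1 < p.2)%N}.

HB.instance Definition _ := Finite.on pairs.

Definition ext2dim := #|{: pairs}|.
Definition fst_ix (k : 'I_ext2dim) : 'I_m := (val (enum_val k)).1.
Definition snd_ix (k : 'I_ext2dim) : 'I_m := (val (enum_val k)).2.

Definition wedge (v w : 'cV[F]_m) : 'cV[F]_ext2dim :=
  \col_k (v (fst_ix k) 0 * w (snd_ix k) 0 - v (snd_ix k) 0 * w (fst_ix k) 0).

(* The Pluecker image of the Grassmannian of lines of P(F^m). *)
Definition grassmannian : set (proj F ext2dim) :=
  [set P | exists v w, free [:: v; w] /\ coords P (wedge v w)].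

(* The antisymmetric matrix A is the linear form e_i /\ e_j |-> A i j. *)
Definition hyperplane (A : 'M[F]_m) : set (proj F ext2dim) :=
  [set P | forall x, coords P x -> \sum_k A (fst_ix k) (snd_ix k) * x k 0 = 0].

Lemma wedge_formE (A : 'M[F]_m) v w : A^T = - A -> (forall i, A i i = 0) ->
  \sum_k A (fst_ix k) (snd_ix k) * wedge v w k 0 = (v^T *m A *m w) 0 0.
Proof.
move=> AT A0.
pose g (p : 'I_m * 'I_m) := v p.1 0 * A p.1 p.2 * w p.2 0.
have -> : (v^T *m A *m w) 0 0 = \sum_p g p.
  rewrite mxE -(pair_bigA _ (fun i j => g (i, j))) exchange_big /=.
  apply: eq_bigr => j _; rewrite mxE mulr_suml.
  by apply: eq_bigr => i _; rewrite mxE.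
have -> : \sum_k A (fst_ix k) (snd_ix k) * wedge v w k 0 =
    \sum_(q : pairs) (g (val q) + g ((val q).2, (val q).1)).
  rewrite (reindex (fun k : 'I_ext2dim => enum_val k : pairs)) /=; last first.
    by exists enum_rank => q _; rewrite ?enum_valK ?enum_rankK.
  apply: eq_bigr => k _; rewrite mxE /g /= -/(fst_ix k) -/(snd_ix k).
  have -> : A (snd_ix k) (fst_ix k) = - A (fst_ix k) (snd_ix k).
    by move/matrixP: AT => /(_ (fst_ix k) (snd_ix k)); rewrite !mxE.
  by rewrite mulrN mulNr mulrBr !mulrA; congr (_ * _ - _ * _); rewrite mulrC.
have lt_sum (h : 'I_m * 'I_m -> F) :
    \sum_(q : pairs) h (val q) =
    \sum_(p : 'I_m * 'I_m | (p.1 < p.2)%N) h p.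
  by rewrite (reindex_omap (val : pairs -> _) insub) => [|p Pp];
     [apply: eq_bigl => q; rewrite (valP q) valK eqxx|rewrite insubT].
rewrite (lt_sum (fun p => g p + g (p.2, p.1))) big_split /=.
rewrite [RHS](bigID (fun p : 'I_m * 'I_m => (p.1 < p.2)%N)) /=; congr (_ + _).
rewrite [RHS](bigID (fun p : 'I_m * 'I_m => p.1 == p.2)) /= [X in _ = X + _]big1 ?add0r; last first.
  by move=> [i j] /andP[_ /= /eqP->]; rewrite /g /= A0 mulr0 mul0r.
rewrite (reindex (fun p : 'I_m * 'I_m => (p.2, p.1))) /=; last first.
  by exists (fun p => (p.2, p.1)) => -[].
by apply: eq_big => [[i j]|[i j] _] //=; rewrite -leqNgt ltn_neqAle andbC eq_sym.
Qed.

End LineGrassmannian.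

Arguments grassmannian : clear implicits.

Section Symplectic.
Variables (F : closedFieldType) (m : nat) (A : 'M[F]_m).

(* The matrices preserving the bilinear form (v, w) |-> v^T A w. *)
Definition Sp := {T : 'M[F]_m | (T \in unitmx) && (T^T *m A *m T == A)}.

HB.instance Definition _ := SubChoice.on Sp.

Implicit Types S T : Sp.

Lemma sp_one_subproof :
  ((1%:M : 'M[F]_m) \in unitmx) && ((1%:M)^T *m A *m 1%:M == A).
Proof. by rewrite unitmx1 trmx1 mul1mx mulmx1 eqxx. Qed.

Lemma sp_mul_subproof S T : let M := val S *m val T in
  (M \in unitmx) && (M^T *m A *m M == A).
Proof.
have /andP[uS /eqP AS] := valP S; have /andP[uT /eqP AT] := valP T.
rewrite /= unitmx_mul uS uT trmx_mul !mulmxA.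
by rewrite -(mulmxA (val T)^T) -(mulmxA (val T)^T) AS AT eqxx.
Qed.

Lemma sp_inv_subproof S : let M := invmx (val S) in
  (M \in unitmx) && (M^T *m A *m M == A).
Proof.
have /andP[] := valP S; move: (val S) => {S} M uM /eqP MA.
by rewrite /= unitmx_inv uM trmx_inv -{1}MA -!mulmxA mulmxV // mulmx1 mulKmx ?unitmx_tr ?eqxx.
Qed.

Lemma sp_opp_subproof S : let M := - val S in
  (M \in unitmx) && (M^T *m A *m M == A).
Proof.
have /andP[] := valP S; move: (val S) => {S} M uM MA /=.
have -> : (- M)^T = - M^T by apply/matrixP => i j; rewrite !mxE.
rewrite mulNmx mulNmx mulmxN opprK MA andbT.
by rewrite -scaleN1r unitmxZ ?unitrN1.
Qed.

Definition sp_one : Sp := exist _ 1%:M sp_one_subproof.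
Definition sp_mul S T : Sp := exist _ (val S *m val T) (sp_mul_subproof S T).
Definition sp_inv S : Sp := exist _ (invmx (val S)) (sp_inv_subproof S).
Definition sp_opp S : Sp := exist _ (- val S) (sp_opp_subproof S).

Lemma sp_mulA : associative sp_mul.
Proof. by move=> S T U; apply: val_inj; exact: mulmxA. Qed.
Lemma sp_mul1 : left_id sp_one sp_mul.
Proof. by move=> S; apply: val_inj; exact: mul1mx. Qed.
Lemma sp_mulr1 : right_id sp_one sp_mul.
Proof. by move=> S; apply: val_inj; exact: mulmx1. Qed.
Lemma sp_mulV : left_inverse sp_one sp_inv sp_mul.
Proof. by move=> S; apply: val_inj; apply: mulVmx; case/andP: (valP S). Qed.
Lemma sp_mulrV : right_inverse sp_one sp_inv sp_mul.
Proof. by move=> S; apply: val_inj; apply: mulmxV; case/andP: (valP S). Qed.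

HB.instance Definition _ := isGroup.Build Sp
  sp_mulA sp_mul1 sp_mulr1 sp_mulV sp_mulrV.

(* Congruence modulo the central subgroup {1, -1}. *)
Definition sp_eqpm S T := (S == T) || (S == sp_opp T).

Lemma sp_oppK : involutive sp_opp.
Proof. by move=> S; apply: val_inj; exact: opprK. Qed.

Lemma sp_eqpm_refl : reflexive sp_eqpm.
Proof. by move=> S; rewrite /sp_eqpm eqxx. Qed.
Lemma sp_eqpm_sym S T : sp_eqpm S T = sp_eqpm T S.
Proof.
rewrite /sp_eqpm eq_sym; congr orb.
by apply/eqP/eqP => ->; rewrite sp_oppK.
Qed.
Lemma sp_eqpm_trans : transitive sp_eqpm.
Proof.
move=> T S U /orP[]/eqP-> /orP[]/eqP->; rewrite /sp_eqpm ?sp_oppK eqxx ?orbT //.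
Qed.

Canonical sp_eqpm_equiv :=
  EquivRel sp_eqpm sp_eqpm_refl sp_eqpm_sym sp_eqpm_trans.

Definition PSp := {eq_quot sp_eqpm}.

HB.instance Definition _ := Choice.on PSp.
HB.instance Definition _ := EqQuotient.on PSp.

Definition psp_one : PSp := \pi_PSp (1%g : Sp).
Definition psp_mul (x y : PSp) : PSp := \pi_PSp (repr x * repr y)%g.
Definition psp_inv (x : PSp) : PSp := \pi_PSp (repr x)^-1%g.

Lemma psp_eqP S T : reflect (S = T \/ S = sp_opp T) (\pi_PSp S == \pi_PSp T).
Proof.
by rewrite eqquotE; apply: (iffP orP) => -[/eqP|/eqP]; [left|right|left|right].
Qed.

Lemma psp_mulE S T : psp_mul (\pi_PSp S) (\pi_PSp T) = \pi_PSp (S * T)%g.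
Proof.
apply/eqP/psp_eqP.
have /eqP/psp_eqP S' := reprK (\pi_PSp S).
have /eqP/psp_eqP T' := reprK (\pi_PSp T).
case: S' T' => -> [] ->; [left=> //|right|right|left]; apply: val_inj => /=.
- exact: mulmxN.
- exact: mulNmx.
- by rewrite mulNmx mulmxN opprK.
Qed.

Lemma psp_invE S : psp_inv (\pi_PSp S) = \pi_PSp S^-1%g.
Proof.
apply/eqP/psp_eqP.
have /eqP/psp_eqP[->|->] := reprK (\pi_PSp S); [by left|right].
have uS : val S \in unitmx by case/andP: (valP S).
by apply: val_inj => /=; rewrite -scaleN1r invmxZ ?unitmxZ ?unitrN1 // invrN1 scaleN1r.
Qed.

Lemma psp_mulA : associative psp_mul.
Proof.
elim/quotW=> S; elim/quotW=> T; elim/quotW=> U.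
by rewrite (psp_mulE T U) (psp_mulE S T) !psp_mulE mulgA.
Qed.
Lemma psp_mul1 : left_id psp_one psp_mul.
Proof. by elim/quotW=> S; rewrite psp_mulE mul1g. Qed.
Lemma psp_mulr1 : right_id psp_one psp_mul.
Proof. by elim/quotW=> S; rewrite psp_mulE mulg1. Qed.
Lemma psp_mulV : left_inverse psp_one psp_inv psp_mul.
Proof. by elim/quotW=> S; rewrite psp_invE psp_mulE mulVg. Qed.
Lemma psp_mulrV : right_inverse psp_one psp_inv psp_mul.
Proof. by elim/quotW=> S; rewrite psp_invE psp_mulE mulgV. Qed.

HB.instance Definition _ := isGroup.Build PSp
  psp_mulA psp_mul1 psp_mulr1 psp_mulV psp_mulrV.

End Symplectic.

(* Main.v *)
(* Write w for the symplectic form A and X for the variety of w-isotropic lines.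
   Let f be an automorphism of X with inverse g.

   A regular map composed with a one-parameter family of parametrised rational
   curves has the same degree on all members of the family. Hence f sends each
   line of X to a curve C of degree 1: C deforms inside X to a deg(C)-fold cover
   of a line, g sends C to a line, and so deg(C) divides 1.

   Two points of X are joined by a line of X if and only if the corresponding
   isotropic lines meet, so f preserves this relation; it then permutes the
   stars of isotropic lines through a point, and induces a bijection of P(F^m)
   which preserves orthogonality and is projective on non-isotropic lines. By
   the argument of the fundamental theorem of projective geometry this bijection
   is linear, and it is symplectic after rescaling. The matrices acting
   trivially are the scalars in Sp, that is 1 and -1.

   Transitivity: a transvection carries p /\ q to p /\ q' when w(q, q') != 0,
   and any two isotropic lines are linked by a chain of such moves. *)
Require Import Defs.
From HB Require Import structures.
From mathcomp Require Import all_boot all_order all_algebra.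
From mathcomp Require Import boolp classical_sets reals complex mpoly.
From mathcomp Require Import ring.

Set Implicit Arguments.
Unset Strict Implicit.
Unset Printing Implicit Defensive.

Import GRing.Theory.
Local Open Scope classical_set_scope.
Local Open Scope ring_scope.
Local Open Scope quotient_scope.

(** * Points and evaluation of polynomial curves *)

(** Degrees are handled without line bundles: a curve is a column of binary forms without common
    zero, a family of curves a column over F[s][t]. The obstacle is that f is given only locally.
    Over a family its local expressions must be replaced by one global representative that is
    nonzero on each fibre in use, also at t = infinity.

    The families are linear pencils of curves. They stay in X because they consist of transvection
    orbits, or lie among the isotropic lines through one point. A cover of a line is a good end
    point since its image is found by substitution: if g sends the line to a curve of degree d, it
    sends the e-fold cover to one of degree e d.

    In general the fundamental theorem leaves a field automorphism. Here degree 1 excludes it: f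
    carries M0 + t M1 to w0 + t w1 with the same parameter t. *)

Section ProjectivePoints.
Variable F : closedFieldType.

Lemma coords_exists k (P : proj F k) : exists x, coords P x.
Proof.
have /eqP P1 := valP P; exists (vpick (val P)).
apply/esym/eqP; rewrite eqEdim -memvE memv_pick /= P1 dim_vline vpick0.
by rewrite -dimv_eq0 P1.
Qed.

Lemma proj_of_coords k (x : 'cV[F]_k) : x != 0 -> exists P : proj F k, coords P x.
Proof.
move=> x0; have h : \dim <[x]>%VS == 1%N by rewrite dim_vline x0.
by exists (exist _ <[x]>%VS h).
Qed.

Lemma coordsZ k (P : proj F k) c x : c != 0 -> coords P x -> coords P (c *: x).
Proof.
move=> c0; rewrite /coords => ->; apply/eqP; rewrite eqEdim; apply/andP; split.
  by rewrite -memvE; apply/vlineP; exists c^-1; rewrite scalerA mulVf // scale1r.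
by rewrite !dim_vline scaler_eq0 negb_or c0; case: (x != 0).
Qed.

Lemma coords_inj k (P Q : proj F k) x : coords P x -> coords Q x -> P = Q.
Proof. by move=> Px Qx; apply: val_inj; rewrite Px Qx. Qed.

End ProjectivePoints.

Section Evaluation.
Variable F : closedFieldType.

(* Value at a point of P^1 of a binary form of degree e, dehomogenised; None is
   the point at infinity. *)
Definition pev e (z : option F) (p : {poly F}) : F :=
  if z is Some t then p.[t] else p`_e.

Definition ev k j e (C : 'M[{poly F}]_(k, j)) (z : option F) : 'M[F]_(k, j) :=
  map_mx (pev e z) C.

Definition degree_le (R : nzRingType) k e (C : 'cV[{poly R}]_k) :=
  forall i, (size (C i 0)%R <= e.+1)%N.

Lemma pevD e z p q : pev e z (p + q) = pev e z p + pev e z q.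
Proof. by case: z => [t|] /=; rewrite ?hornerD ?coefD. Qed.

Lemma pevB e z p q : pev e z (p - q) = pev e z p - pev e z q.
Proof. by case: z => [t|] /=; rewrite ?hornerD ?hornerN ?coefB. Qed.

Lemma pev0 e z : pev e z 0 = 0.
Proof. by case: z => [t|] /=; rewrite ?horner0 ?coef0. Qed.

Lemma pevZ e z c p : pev e z (c *: p) = c * pev e z p.
Proof. by case: z => [t|] /=; rewrite ?hornerZ ?coefZ. Qed.

Lemma pev_sum e z (I : Type) (r : seq I) (P : pred I) (G : I -> {poly F}) :
  pev e z (\sum_(i <- r | P i) G i) = \sum_(i <- r | P i) pev e z (G i).
Proof. exact: (big_morph _ (pevD e z) (pev0 e z)). Qed.

(** This is the multiplicativity of evaluation at infinity. *)
Lemma coef_topM (R : nzRingType) a b (p q : {poly R}) :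
  (size p <= a.+1)%N -> (size q <= b.+1)%N -> (p * q)`_(a + b) = p`_a * q`_b.
Proof.
move=> pa qb; rewrite coefM (bigD1 (inord a)) //= inordK ?ltnS ?leq_addr //.
rewrite addKn big1 ?addr0 // => i ine.
have {}ine : (i : nat) != a.
  by apply: contraNneq ine => ia; apply/eqP/val_inj; rewrite /= inordK ?ltnS ?leq_addr.
have [lt_ai|] := ltnP a i; first by rewrite nth_default ?mul0r // (leq_trans pa).
rewrite leq_eqVlt (negPf ine) /= => lt_ia.
rewrite [q`_ _]nth_default ?mulr0 // (leq_trans qb) //.
by rewrite -addnBAC ?(ltnW lt_ia) // -addn1 addnC leq_add // subn_gt0.
Qed.

Lemma size_topM (R : nzRingType) a b (p q : {poly R}) :
  (size p <= a.+1)%N -> (size q <= b.+1)%N -> (size (p * q)%R <= (a + b).+1)%N.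
Proof.
move=> pa qb; apply: leq_trans (size_polyMleq p q) _.
apply: (@leq_trans (a.+1 + b.+1).-1); last by rewrite addSn addnS.
by rewrite -!subn1 leq_sub2r // leq_add.
Qed.

Lemma pevM a b z (p q : {poly F}) : (size p <= a.+1)%N -> (size q <= b.+1)%N ->
  pev (a + b) z (p * q) = pev a z p * pev b z q.
Proof. by case: z => [t|] /= pa qb; rewrite ?hornerM ?coef_topM. Qed.

Lemma size_topX (R : nzRingType) a (p : {poly R}) d :
  (size p <= a.+1)%N -> (size (p ^+ d)%R <= (a * d).+1)%N.
Proof.
move=> pa; elim: d => [|d IH]; first by rewrite expr0 muln0 size_poly1.
by rewrite exprS mulnS; apply: size_topM.
Qed.

Lemma pevX a z (p : {poly F}) d : (size p <= a.+1)%N -> pev (a * d) z (p ^+ d) = pev a z p ^+ d.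
Proof.
move=> pa; elim: d => [|d IH].
  by rewrite !expr0 muln0; case: z => [t|] /=; rewrite ?hornerC ?coef1.
by rewrite !exprS mulnS pevM ?IH //; apply: size_topX.
Qed.

Lemma size_topprod (R : comNzRingType) (I : Type) (r : seq I) (n : I -> nat)
    (G : I -> {poly R}) : (forall i, size (G i) <= (n i).+1)%N ->
  (size (\prod_(i <- r) G i)%R <= (\sum_(i <- r) n i).+1)%N.
Proof.
move=> Gn; elim: r => [|i r IH]; first by rewrite !big_nil size_poly1.
by rewrite !big_cons size_topM.
Qed.

Lemma pev_prod z (I : Type) (r : seq I) (n : I -> nat) (G : I -> {poly F}) :
  (forall i, size (G i) <= (n i).+1)%N ->
  pev (\sum_(i <- r) n i) z (\prod_(i <- r) G i) = \prod_(i <- r) pev (n i) z (G i).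
Proof.
move=> Gn; elim: r => [|i r IH].
  by rewrite !big_nil; case: z => [t|] /=; rewrite ?hornerC ?coef1.
by rewrite !big_cons pevM ?IH //; apply: size_topprod.
Qed.

Lemma ev_mulmx k l j e (N : 'M[F]_(k, l)) (C : 'M_(l, j)) z :
  ev e (map_mx polyC N *m C) z = N *m ev e C z.
Proof.
apply/matrixP => i i'; rewrite !mxE pev_sum; apply: eq_bigr => i0 _.
by rewrite !mxE mul_polyC pevZ.
Qed.

Lemma ev_mulmxr k l j e (N : 'M[F]_(l, j)) (C : 'M_(k, l)) z :
  ev e (C *m map_mx polyC N) z = ev e C z *m N.
Proof.
apply/matrixP => i i'; rewrite !mxE pev_sum; apply: eq_bigr => i0 _.
by rewrite !mxE mulrC mul_polyC pevZ mulrC.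
Qed.

Lemma degree_le_mulmx k l e (N : 'M[F]_(k, l)) C :
  degree_le e C -> degree_le e (map_mx polyC N *m C : 'cV_k).
Proof.
move=> Ce i; rewrite mxE; apply: (leq_trans (size_sum _ _ _)).
apply/bigmax_leqP => j _; rewrite mxE mul_polyC.
by apply: leq_trans (size_scale_leq _ _) _.
Qed.

Lemma evD k j e (C C' : 'M[{poly F}]_(k, j)) z :
  ev e (C + C') z = ev e C z + ev e C' z.
Proof. by apply/matrixP => i i'; rewrite !mxE pevD. Qed.

Lemma evB k j e (C C' : 'M[{poly F}]_(k, j)) z :
  ev e (C - C') z = ev e C z - ev e C' z.
Proof. by apply/matrixP => i i'; rewrite !mxE pevB. Qed.

Lemma evZ k j e c (C : 'M[{poly F}]_(k, j)) z : ev e (c%:P *: C) z = c *: ev e C z.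
Proof. by apply/matrixP => i i'; rewrite !mxE mul_polyC pevZ. Qed.

(** The target ring is left open because curves over F[t] and families over F[s][t] are both
    substituted, with coefficient maps [polyC] and [cst]. *)
Definition subst k (R : comNzRingType) (h : F -> R) (v : 'cV[R]_k)
  (G : {mpoly F[k]}) : R := mmap h (fun i => v i 0) G.

Lemma subst_rmorph k (R S : comNzRingType) (h : F -> R) (h' : F -> S)
    (g : {rmorphism R -> S}) (v : 'cV[R]_k) G :
  (forall c, g (h c) = h' c) -> g (subst h v G) = subst h' (map_mx g v) G.
Proof.
move=> gh; rewrite /subst /mmap rmorph_sum; apply: eq_bigr => m _.
rewrite rmorphM gh; congr (_ * _); rewrite /mmap1 rmorph_prod.
by apply: eq_bigr => i _; rewrite rmorphXn !mxE.
Qed.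

Lemma subst_size k (R : comNzRingType) (h : F -> R)
    (v : 'cV[{poly R}]_k) (hP : F -> {poly R}) G d e :
  (forall c, hP c = (h c)%:P) ->
  G \is d.-homog -> degree_le e v -> (size (subst hP v G) <= (e * d).+1)%N.
Proof.
move=> hPE /dhomogP Gd ve; rewrite /subst /mmap big_seq.
apply: (leq_trans (size_sum _ _ _)); apply/bigmax_leqP_seq => m mG _.
rewrite hPE mul_polyC; apply: (leq_trans (size_scale_leq _ _)); rewrite /mmap1.
have /= <- := Gd m mG; rewrite mdegE big_distrr /=.
by apply: size_topprod => i; apply: size_topX.
Qed.

Lemma pev_subst k (v : 'cV[{poly F}]_k) G d e z :
  G \is d.-homog -> degree_le e v ->
  pev (e * d) z (subst polyC v G) = evalv G (ev e v z).
Proof.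
move=> /dhomogP Gd ve; rewrite /subst /mmap /evalv mevalE big_seq [RHS]big_seq.
rewrite pev_sum; apply: eq_bigr => m mG.
rewrite mul_polyC pevZ; congr (_ * _); rewrite /mmap1.
have /= <- := Gd m mG; rewrite mdegE big_distrr /= pev_prod.
  by apply: eq_bigr => i _; rewrite pevX // mxE.
by move=> i; apply: size_topX.
Qed.

Lemma poly_eq0_horner (p : {poly F}) : (forall t, p.[t] = 0) -> p = 0.
Proof.
move=> p0; apply/eqP; apply/negPn/negP => /closed_nonrootP[x].
by rewrite rootE p0 eqxx.
Qed.

(** In [{poly {poly F}}] the outer variable t runs along a curve and the inner variable s along the
    family; [spec] fixes s. *)
Definition cst (c : F) : {poly {poly F}} := c%:P%:P.

Definition spec (s : F) : {poly {poly F}} -> {poly F} := map_poly (horner_eval s).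
HB.instance Definition _ s := GRing.RMorphism.on (spec s).

Lemma specC s c : spec s c%:P = c.[s]%:P.
Proof. by rewrite /spec map_polyC. Qed.

Lemma spec_subst k s (v : 'cV[{poly {poly F}}]_k) G :
  spec s (subst cst v G) = subst polyC (map_mx (spec s) v) G.
Proof. by apply: subst_rmorph => c; rewrite /= /cst specC hornerC. Qed.

Lemma coef_spec s p j : (spec s p)`_j = (p`_j).[s].
Proof. by rewrite /spec coef_map. Qed.

Lemma size_spec s p : (size (spec s p) <= size p)%N.
Proof. exact: size_poly. Qed.

Lemma poly2_eq0 (p : {poly {poly F}}) :
  (forall s t, (spec s p).[t] = 0) -> p = 0.
Proof.
move=> p0; apply/polyP => j; rewrite coef0; apply: poly_eq0_horner => s.
by rewrite -coef_spec (poly_eq0_horner (p0 s)) coef0.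
Qed.

Lemma spec_eq0_div s (p : {poly {poly F}}) :
  spec s p = 0 -> exists q, p = ('X - s%:P)%:P * q.
Proof.
move=> p0; exists (map_poly (fun c => c %/ ('X - s%:P)) p).
apply/polyP => j; rewrite coefCM coef_map_id0 ?div0p // mulrC divpK //.
by rewrite dvdp_XsubCl rootE -coef_spec p0 coef0.
Qed.

End Evaluation.

Arguments cst {F}.

(** * Regular maps on one-parameter families of curves *)

Section Representatives.
Variable F : closedFieldType.
Variables (k l : nat) (X : set (proj F k)) (Y : set (proj F l)) (f : X -> Y).
Hypothesis f_reg : regular f.

(** Shrinking the open set to one basic set p != 0 leaves a single polynomial p, into which a family
    can be substituted. *)
Lemma regular_local (P : X) x : coords (val P) x ->
  exists d (G : 'I_l -> {mpoly F[k]}) b (p : {mpoly F[k]}),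
    [/\ forall i, G i \is d.-homog, p \is b.-homog, evalv p x != 0 &
        forall (Q : X) y, coords (val Q) y -> evalv p y != 0 ->
          coords (val (f Q)) (\col_i evalv (G i) y)].
Proof.
move=> Px; have [U [d [G [[S S_hom US] UP G_hom fE]]]] := f_reg P.
have [p [y [Sp Py py]]] := (US _).1 UP.
have [b p_hom] := S_hom _ Sp; exists d, G, b, p; split=> //.
  have [c c0 ->] := coords_scale Py Px.
  by rewrite (evalvZ _ _ p_hom) mulf_neq0 // expf_neq0.
by move=> Q z Qz pz; apply: fE => //; apply/US; exists p, z.
Qed.

Variables (Phi : 'cV[{poly {poly F}}]_k) (e : nat).
Hypothesis Phi_deg : degree_le e Phi.

Let fiber s : 'cV[{poly F}]_k := map_mx (spec s) Phi.
Let value s z := ev e (fiber s) z.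

Hypothesis Phi_X :
  forall s z, value s z != 0 -> exists Q : X, coords (val Q) (value s z).

Local Notation K := {poly {poly F}}.

(* W represents f o Phi away from the zeros of q, up to a possibly vanishing
   factor. *)
Definition represents (W : 'cV[K]_l) := exists2 q : K, q != 0 &
  forall s t (Q : X), (spec s q).[t] != 0 -> coords (val Q) (value s (Some t)) ->
    ev 0 (map_mx (spec s) W) (Some t) \in val (val (f Q)).

(** Since [represents] asks for membership in a line and not for [coords], representatives form a
    module, which makes division with remainder available. *)
Lemma represents_lin W W' a b : represents W -> represents W' ->
  represents (a *: W + b *: W').
Proof.
move=> [q q0 qW] [q' q'0 qW']; exists (q * q'); first exact: mulf_neq0.
move=> s t Q; rewrite rmorphM hornerM mulf_eq0 negb_or => /andP[qt q't] Qv.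
have -> : ev 0 (map_mx (spec s) (a *: W + b *: W')) (Some t) =
   (spec s a).[t] *: ev 0 (map_mx (spec s) W) (Some t) +
   (spec s b).[t] *: ev 0 (map_mx (spec s) W') (Some t).
  by apply/colP => i; rewrite !mxE /= rmorphD !rmorphM hornerD !hornerM.
by rewrite rpredD // rpredZ //; [apply: qW|apply: qW'].
Qed.

Lemma represents_div (W : 'cV[K]_l) c : c != 0 -> represents (c *: W) ->
  represents W.
Proof.
move=> c0 [q q0 qW]; exists (q * c); first exact: mulf_neq0.
move=> s t Q; rewrite rmorphM hornerM mulf_eq0 negb_or => /andP[qt ct] Qv.
have -> : ev 0 (map_mx (spec s) W) (Some t) =
  ((spec s c).[t])^-1 *: ev 0 (map_mx (spec s) (c *: W)) (Some t).
  by apply/colP => i; rewrite !mxE /= rmorphM hornerM mulKf.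
by apply: memvZ; apply: qW.
Qed.

Hypothesis Phi_neq0 : Phi != 0.

(** Off the zeros of q, q' and one coordinate of [Phi], both columns lie on the same line. So the
    minor times these three polynomials vanishes everywhere, and the three are nonzero. *)
Lemma represents_prop W W' i j : represents W -> represents W' ->
  W i 0 * W' j 0 = W j 0 * W' i 0.
Proof.
move=> [q q0 qW] [q' q'0 qW'].
have [i0 Pi0] : exists i0, Phi i0 0 != 0.
  apply/existsP; rewrite -negb_forall; apply: contraNN Phi_neq0 => /forallP h.
  by apply/eqP/colP => a; rewrite mxE; apply/eqP.
apply/eqP; rewrite -subr_eq0.
suff /eqP : (W i 0 * W' j 0 - W j 0 * W' i 0) * (q * q' * Phi i0 0) = 0.
  by rewrite !mulf_eq0 (negPf q0) (negPf q'0) (negPf Pi0) !orbF.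
apply: poly2_eq0 => s t; rewrite !rmorphM !hornerM.
have [/eqP ->|] := boolP ((spec s q).[t] == 0); first by rewrite !mul0r mulr0.
have [/eqP ->|] := boolP ((spec s q').[t] == 0); first by rewrite mulr0 mul0r mulr0.
have [/eqP ->|P0 q't qt] := boolP ((spec s (Phi i0 0)).[t] == 0).
  by rewrite !mulr0.
have /Phi_X[Q Qv] : value s (Some t) != 0.
  by apply: contraNneq P0 => /colP/(_ i0); rewrite !mxE /= => ->.
have [y Qy] := coords_exists (val (f Q)).
have := qW s t Q qt Qv; have := qW' s t Q q't Qv; rewrite Qy.
move=> /vlineP[b /colP bE] /vlineP[a /colP aE].
have {}aE j' : (spec s (W j' 0)).[t] = a * y j' 0 by have := aE j'; rewrite !mxE.
have {}bE j' : (spec s (W' j' 0)).[t] = b * y j' 0 by have := bE j'; rewrite !mxE.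
rewrite !(rmorphM, rmorphB, hornerM, hornerD, hornerN) /= !aE !bE.
by rewrite !mulrA ![a * _ * b]mulrAC -!mulrA [y i 0 * y j 0]mulrC subrr !mul0r.
Qed.

(** The denominator is p substituted in [Phi]; one point of the family, possibly at infinity, where
    p is nonzero shows that it is not the zero polynomial. *)
Lemma represents_local (G : 'I_l -> {mpoly F[k]}) b (p : {mpoly F[k]}) s z :
  p \is b.-homog -> evalv p (value s z) != 0 ->
  (forall (Q : X) y, coords (val Q) y -> evalv p y != 0 ->
     coords (val (f Q)) (\col_i evalv (G i) y)) ->
  represents (\col_i subst cst Phi (G i)).
Proof.
have subst0 G' s' t : (subst polyC (fiber s') G').[t] = evalv G' (value s' (Some t)).
  have hC c : horner_eval t (polyC c) = idfun c by rewrite /horner_eval hornerC.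
  rewrite -[LHS]/(horner_eval t _) (subst_rmorph _ _ hC).
  rewrite /subst /evalv /meval; congr mmap; apply: funext => i; rewrite !mxE //.
move=> p_hom pz fE; exists (subst cst Phi p).
  apply: contraNneq pz => p0; rewrite -(pev_subst _ p_hom) -?spec_subst ?p0 ?rmorph0 ?pev0 //.
  by move=> i; rewrite mxE; apply: leq_trans (size_spec _ _) (Phi_deg _).
move=> s' t Q; rewrite spec_subst subst0 => pt Qv.
have := fE Q _ Qv pt; rewrite {1}/coords => ->.
suff -> : ev 0 (map_mx (spec s') (\col_i subst cst Phi (G i))) (Some t) =
  \col_i evalv (G i) (value s' (Some t)) by exact: memv_line.
by apply/colP => i; rewrite !mxE /= spec_subst subst0.
Qed.

(** Only the degree in t is minimised; the degree in s is free. *)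
Definition minimal_rep (W : 'cV[K]_l) n := [/\ W != 0, represents W,
  (forall i, size (W i 0)%R <= n.+1)%N &
  forall W' m, W' != 0 -> represents W' -> (forall i, size (W' i 0)%R <= m.+1)%N ->
    (n <= m)%N].

Lemma minimal_rep_exists W : W != 0 -> represents W ->
  exists W' n, minimal_rep W' n.
Proof.
move=> W0 Wr.
pose P n := `[< exists W', [/\ W' != 0, represents W' &
  (forall i, size (W' i 0)%R <= n.+1)%N] >].
have exP : exists n, P n.
  exists (\max_i size (W i 0)%R); apply/asboolP; exists W; split=> // i.
  by apply: leqW; exact: leq_bigmax.
case: (ex_minnP exP) => n /asboolP[W' [W'0 W'r W'n]] n_min.
exists W', n; split=> // W'' m W''0 W''r W''m; apply: n_min.
by apply/asboolP; exists W''.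
Qed.

Lemma minimal_rep_size W n : minimal_rep W n -> exists i, size (W i 0)%R = n.+1.
Proof.
move=> [W0 Wr Wn Wmin].
have [/existsP[i /eqP]|] := boolP [exists i, size (W i 0)%R == n.+1]; first by exists i.
rewrite negb_exists => /forallP Wne; exfalso.
have Wlt i : (size (W i 0)%R <= n)%N.
  by have := Wn i; rewrite leq_eqVlt (negPf (Wne i)).
case: n Wn Wmin Wne Wlt => [|n] Wn Wmin Wne Wlt.
  case/eqP: W0; apply/colP => i; rewrite mxE; apply/eqP.
  by rewrite -size_poly_leq0.
by have := Wmin W n W0 Wr Wlt; rewrite ltnn.
Qed.

(* Pseudo-division of W' by W leaves a remainder of smaller degree, which
   minimality forces to vanish. *)
Lemma minimal_rep_dvd W n W' : minimal_rep W n -> represents W' ->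
  exists c kappa, c != 0 /\ c%:P *: W' = kappa *: W.
Proof.
move=> Wmin W'r; have [i0 Wi0] := minimal_rep_size Wmin.
have [W0 Wr Wn min_n] := Wmin.
have Wi0_neq0 : W i0 0 != 0 by rewrite -size_poly_eq0 Wi0.
pose c := lead_coef (W i0 0) ^+ scalp (W' i0 0) (W i0 0).
pose kappa := W' i0 0 %/ W i0 0; pose V := c%:P *: W' - kappa *: W.
exists c, kappa; split; first by rewrite expf_neq0 // lead_coef_eq0.
apply/eqP; rewrite -subr_eq0 -/V; apply/negPn/negP => V0.
have Vr : represents V by rewrite /V -scaleNr; apply: represents_lin.
have Vi0 : V i0 0 = W' i0 0 %% W i0 0.
  by rewrite !mxE mul_polyC Pdiv.Idomain.divp_eq addrC addKr.
have Vi0_lt : (size (V i0 0)%R < n.+1)%N by rewrite Vi0 -Wi0 ltn_modp.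
have [Vi00|Vi00] := eqVneq (V i0 0) 0.
  case/eqP: V0; apply/colP => j; rewrite [RHS]mxE; apply/eqP.
  have := represents_prop i0 j Vr Wr; rewrite Vi00 mul0r => /esym/eqP.
  by rewrite mulf_eq0 (negPf Wi0_neq0) orbF.
have : (0 < size (V i0 0)%R)%N by rewrite size_poly_gt0.
case def_m : (size (V i0 0)%R) => [//|m] _; rewrite def_m ltnS in Vi0_lt.
suff /(min_n V m V0 Vr) : forall j, (size (V j 0)%R <= m.+1)%N by rewrite leqNgt Vi0_lt.
move=> j; have [->|Vj] := eqVneq (V j 0) 0; first by rewrite size_poly0.
(* By proportionality the degree drops by the same amount in all nonzero coordinates, so V
   contradicts the minimality of W. *)
have := represents_prop i0 j Vr Wr => VW.
have Wj : W j 0 != 0.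
  apply/negP => /eqP Wj0; move/eqP: VW; rewrite Wj0 mulr0 eq_sym mulf_eq0.
  by rewrite (negPf Vj) (negPf Wi0_neq0).
have := congr1 (fun p : K => size p) VW; rewrite !size_mul // def_m Wi0.
have := Wn j; rewrite addnS addSn /= => Wjn e_size.
by rewrite -(leq_add2r n) -e_size addSn -addnS leq_add2l.
Qed.
End Representatives.

Section FamilyDegree.
Variable F : closedFieldType.
Variables (k l : nat) (X : set (proj F k)) (Y : set (proj F l)) (f : X -> Y).
Hypothesis f_reg : regular f.
Variables (Phi : 'cV[{poly {poly F}}]_k) (e : nat).
Hypothesis Phi_deg : degree_le e Phi.

Let fiber s : 'cV[{poly F}]_k := map_mx (spec s) Phi.
Let value s z := ev e (fiber s) z.

Hypothesis Phi_X :
  forall s z, value s z != 0 -> exists Q : X, coords (val Q) (value s z).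
Local Notation K := {poly {poly F}}.

(** While the fibre over s vanishes, the factor X - s can be divided out. This keeps all degrees in
    t, and it stops because the degree in s of a chosen nonzero coefficient drops. *)
Lemma minimal_rep_spec W n s : minimal_rep f Phi e W n ->
  exists2 W0, minimal_rep f Phi e W0 n & map_mx (spec s) W0 != 0.
Proof.
move=> Wmin; have [W0 _ _ _] := Wmin.
have [i [j c0]] : exists i j, (W i 0)`_j != 0.
  have [i Wi] : exists i, W i 0 != 0.
    apply/existsP; rewrite -negb_forall; apply: contraNN W0 => /forallP h.
    by apply/eqP/colP => a; rewrite mxE; apply/eqP.
  by exists i, (size (W i 0)%R).-1; rewrite -lead_coefE lead_coef_eq0.
have [N cN] := ubnP (size (W i 0)%R`_j).
elim: N => // N IH in W Wmin W0 c0 cN *.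
have [W0s|Ws] := eqVneq (map_mx (spec s) W) 0; last by exists W.
have /choice[w wE] i' : exists q, W i' 0 = ('X - s%:P)%:P * q.
  by apply: (@spec_eq0_div _ s); have /colP/(_ i') := W0s; rewrite !mxE.
pose W1 : 'cV[K]_l := \col_i' w i'.
have Xs0 : ('X - s%:P)%:P != 0 :> K by rewrite polyC_eq0 polyXsubC_eq0.
have WE : W = ('X - s%:P)%:P *: W1 by apply/colP => i'; rewrite !mxE wE.
have sizeW1 i' : size (W1 i' 0) = size (W i' 0).
  by rewrite WE [in RHS]mxE size_Cmul // polyXsubC_eq0.
have cE : (W i 0)`_j = ('X - s%:P) * (W1 i 0)`_j by rewrite WE mxE coefCM.
have [_ Wr Wn min_n] := Wmin.
apply: (IH W1).
- split=> //; last by move=> i'; rewrite sizeW1.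
    by apply: contraNneq W0 => W10; rewrite WE W10 scaler0.
  by apply: represents_div Xs0 _; rewrite -WE.
- by apply: contraNneq W0 => W10; rewrite WE W10 scaler0.
- by apply: contraNneq c0 => c1; rewrite cE c1 mulr0.
- rewrite -ltnS; apply: leq_trans cN; rewrite cE size_mul ?polyXsubC_eq0 ?size_XsubC ?add2n //.
  by apply: contraNneq c0 => W1c; rewrite cE W1c mulr0.
Qed.

(** If c vanishes at s, so does the fibre of kappa, because that of W is nonzero; the common factor
    X - s then cancels. *)
Lemma cancel_spec (W W' : 'cV[K]_l) c kappa s : map_mx (spec s) W != 0 ->
  c != 0 -> c%:P *: W' = kappa *: W ->
  exists c' kappa', c'.[s] != 0 /\ c'%:P *: W' = kappa' *: W.
Proof.
move=> Ws; have [N] := ubnP (size c); elim: N => // N IH in c kappa *.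
move=> cN c0 cE; have [cs|cs] := eqVneq c.[s] 0; last by exists c, kappa.
have /spec_eq0_div[q qE] : spec s kappa = 0.
  have /(congr1 (map_mx (spec s))) : c%:P *: W' = kappa *: W by [].
  rewrite !map_mxZ /= specC cs polyC0 scale0r => /esym/eqP.
  by rewrite scalemx_eq0 (negPf Ws) orbF => /eqP.
have Xs0 : ('X - s%:P)%:P != 0 :> K by rewrite polyC_eq0 polyXsubC_eq0.
have /dvdpP[c1 c1E] : 'X - s%:P %| c by rewrite dvdp_XsubCl rootE cs.
have c10 : c1 != 0 by apply: contraNneq c0 => c10; rewrite c1E c10 mul0r.
apply: (IH c1 q) => //.
  rewrite -ltnS; apply: leq_trans cN.
  by rewrite c1E size_mul ?polyXsubC_eq0 // size_XsubC addn2.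
apply/eqP; rewrite -subr_eq0.
suff : ('X - s%:P)%:P *: (c1%:P *: W' - q *: W) == 0 by rewrite scalemx_eq0 (negPf Xs0).
by rewrite scalerBr !scalerA -qE -cE c1E mulrC -polyCM subrr.
Qed.

(* A representative W of minimal degree in t satisfies c H = kappa W for every
   local expression H. Once the factors s - s0 of c are cancelled, this relation
   specialises to the fibre over s0; as the degree of H there is the expected
   one, even at infinity, W neither vanishes nor drops its degree. *)
Lemma regular_family_degree : exists D, forall s, (forall z, value s z != 0) ->
  exists w : 'cV[{poly F}]_l, [/\ degree_le D w, forall z, ev D w z != 0 &
    forall z (Q : X), coords (val Q) (value s z) ->
      coords (val (f Q)) (ev D w z)].
Proof.
have [[s1 good]|bad] := pselect (exists s, forall z, value s z != 0); last first.
  by exists 0 => s good; case: bad; exists s.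
have Phi0 : Phi != 0.
  apply: contraNneq (good None) => Phi0.
  by apply/eqP/colP => i; rewrite !mxE Phi0 mxE rmorph0 pev0.
have fiber_deg s : degree_le e (fiber s).
  by move=> i; rewrite mxE; apply: leq_trans (size_spec _ _) (Phi_deg _).
have local s z : value s z != 0 -> exists d (H : 'cV[K]_l),
  [/\ represents f Phi e H, degree_le d H, ev d (map_mx (spec s) H) z != 0 &
   forall Q : X, coords (val Q) (value s z) ->
     coords (val (f Q)) (ev d (map_mx (spec s) H) z)].
  move=> v0; have [P Pv] := Phi_X v0.
  have [d [G [b [p [G_hom p_hom pv fE]]]]] := regular_local f_reg Pv.
  pose H : 'cV[K]_l := \col_i subst cst Phi (G i).
  have HE : ev (e * d) (map_mx (spec s) H) z = \col_i evalv (G i) (value s z).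
    by apply/colP => i; rewrite !mxE /= spec_subst (pev_subst _ (G_hom i) (fiber_deg s)).
  exists (e * d)%N, H; split; rewrite ?HE.
  - by apply: (represents_local Phi_deg p_hom pv).
  - move=> i; rewrite mxE.
    by apply: (subst_size (h := polyC)) (G_hom i) Phi_deg.
  - exact: coords_ne0 (fE P _ Pv pv).
  - by move=> Q Qv; apply: fE.
have [W [D Wmin]] : exists W D, minimal_rep f Phi e W D.
  have [d [H [Hr _ H0 _]]] := local s1 None (good None).
  apply: minimal_rep_exists Hr.
  by apply: contraNneq H0 => ->; apply/eqP/colP => i; rewrite !mxE rmorph0 pev0.
exists D => s s_good.
have [W0 W0min W0s] := minimal_rep_spec s Wmin.
exists (map_mx (spec s) W0).
have [_ _ W0n _] := W0min.
have W0sn : degree_le D (map_mx (spec s) W0).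
  by move=> i; rewrite mxE; apply: leq_trans (size_spec _ _) (W0n _).
have main z : ev D (map_mx (spec s) W0) z != 0 /\
    forall Q : X, coords (val Q) (value s z) ->
      coords (val (f Q)) (ev D (map_mx (spec s) W0) z).
  have [d [H [Hr Hd H0 HE]]] := local s z (s_good z).
  have [c1 [kappa1 [c10 c1E]]] := minimal_rep_dvd Phi_X Phi0 W0min Hr.
  have [c [kappa [cs cE]]] := cancel_spec W0s c10 c1E.
  have [i0 W0i] := minimal_rep_size W0min.
  have c0 : c != 0 by apply: contraNneq cs => ->; rewrite horner0.
  have kappa0 : kappa != 0.
    apply: contraNneq H0 => k0; move/eqP: cE; rewrite k0 scale0r scalemx_eq0.
    rewrite polyC_eq0 (negPf c0) /= => /eqP->.
    by apply/eqP/colP => i; rewrite !mxE rmorph0 pev0.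
  have W0i0 : W0 i0 0 != 0 by rewrite -size_poly_eq0 W0i.
  have size_kappa : (size kappa + D <= d.+1)%N.
    have /colP/(_ i0) := cE; rewrite !mxE => HW.
    by have := Hd i0; rewrite -(size_Cmul _ c0) HW size_mul // W0i addnS.
  have Dd : (D <= d)%N.
    have : (0 < size kappa)%N by rewrite size_poly_gt0.
    move: size_kappa; case: (size kappa) => // a; rewrite addSn ltnS => aD _.
    by apply: leq_trans aD; rewrite leq_addl.
  have kd : (size (spec s kappa) <= (d - D).+1)%N.
    by apply: leq_trans (size_spec _ _) _; rewrite -(leq_add2r D) addSn subnK.
  (* Reading kappa as a form of degree d - D makes the specialised relation valid at infinity too;
     as its left side is nonzero, so are both factors on the right. *)
  have eE : c.[s] *: ev d (map_mx (spec s) H) z =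
      pev (d - D) z (spec s kappa) *: ev D (map_mx (spec s) W0) z.
    apply/colP => i; rewrite !mxE -pevM //; last by have := W0sn i; rewrite mxE.
    have /colP/(_ i) := cE; rewrite !mxE => /(congr1 (spec s)).
    rewrite !rmorphM /= specC mul_polyC.
    by rewrite subnK // => <-; rewrite pevZ.
  have k0 : pev (d - D) z (spec s kappa) != 0.
    apply: contraNneq H0 => k0; move/eqP: eE.
    by rewrite k0 scale0r scaler_eq0 (negPf cs).
  have wE : ev D (map_mx (spec s) W0) z =
     (c.[s] / pev (d - D) z (spec s kappa)) *: ev d (map_mx (spec s) H) z.
    by rewrite mulrC -scalerA eE scalerA mulVf // scale1r.
  have a0 : c.[s] / pev (d - D) z (spec s kappa) != 0 by rewrite mulf_neq0 ?invr_eq0.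
  split; first by rewrite wE scaler_eq0 negb_or a0.
  by move=> Q Qv; rewrite wE; apply: coordsZ a0 (HE Q Qv).
split; first exact: W0sn.
  by move=> z; have [] := main z.
by move=> z Q; have [_ mz] := main z; apply: mz.
Qed.

End FamilyDegree.

(** * Choices avoiding finitely many conditions *)

Section GenericChoices.
Variable F : closedFieldType.

Lemma exists_nonroot (I : eqType) (r : seq I) (p : I -> {poly F}) :
  (forall i, p i != 0) -> exists t, forall i, i \in r -> (p i).[t] != 0.
Proof.
move=> p0; have /closed_nonrootP[t] : \prod_(i <- r) p i != 0.
  by elim: r => [|i r IH]; rewrite ?big_nil ?oner_neq0 // big_cons mulf_neq0.
move=> pt; exists t => i; elim: r pt => [//|j r IH].
rewrite big_cons rootM negb_or inE => /andP[pj /IH {}IH] /orP[/eqP->|/IH //].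
by rewrite -rootE.
Qed.

(* The moment curve meets each of finitely many hyperplanes in finitely many
   points. *)
Lemma exists_functional m (I : eqType) (r : seq I) (v : I -> 'cV[F]_m) :
  (forall i, i \in r -> v i != 0) ->
  exists u : 'rV[F]_m, forall i, i \in r -> u *m v i != 0.
Proof.
(* The default 1 serves indices outside r, since [exists_nonroot] wants every p i nonzero. *)
move=> v0; pose p i := if v i == 0 then 1 else rVpoly (v i)^T.
have /(exists_nonroot r)[t tP] i : p i != 0.
  rewrite /p; have [_|vi] := eqVneq (v i) 0; first by rewrite oner_neq0.
  apply: contraNneq vi => p0; rewrite -[v i]trmxK -[(v i)^T]rVpolyK p0.
  by rewrite linear0 trmx0.
exists (\row_j t ^+ j) => i ri; have := tP i ri; rewrite /p (negPf (v0 i ri)).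
apply: contraNneq => /matrixP/(_ 0 0); rewrite !mxE => e0.
rewrite (horner_coef_wide _ (size_poly _ _)) -[X in _ == X]e0; apply/eqP.
by apply: eq_bigr => j _; rewrite mxE coef_rVpoly_ord mxE mulrC.
Qed.

Lemma finitely_many_zeros e (p : {poly F}) : p != 0 ->
  exists r : seq (option F), forall z, pev e z p = 0 -> z \in r.
Proof.
move=> p0; have [r pE] := closed_field_poly_normal p.
exists (None :: map Some r) => -[t|] //= pt; rewrite inE /= map_f //.
rewrite -root_prod_XsubC rootE; move/eqP: pt.
by rewrite {1}pE hornerZ mulf_eq0 lead_coef_eq0 (negPf p0).
Qed.

Lemma cV_neq0 (R : zmodType) m (v : 'cV[R]_m) : v != 0 -> exists i, v i 0 != 0.
Proof.
move=> v0; apply/existsP; rewrite -negb_forall; apply: contraNN v0 => /forallP h.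
by apply/eqP/colP => i; rewrite mxE; apply/eqP.
Qed.

(** The pair is a projection to P^1 without base point on the curve: l0 has finitely many zeros
    along it, and l1 is chosen nonzero at those. *)
Lemma exists_two_functionals m e (r : 'cV[{poly F}]_m) :
  (forall z, ev e r z != 0) ->
  exists l0 l1 : 'rV[F]_m, forall z, l0 *m ev e r z = 0 -> l1 *m ev e r z != 0.
Proof.
move=> r0; have [l0 l0P] : exists l0 : 'rV[F]_m, l0 *m ev e r (Some 0) != 0.
  have [l lP] := @exists_functional m _ [:: Some 0] (fun z => ev e r z) (fun z _ => r0 z).
  by exists l; apply: lP; rewrite inE.
pose p := (map_mx polyC l0 *m r) 0 0.
have pE z : pev e z p = (l0 *m ev e r z) 0 0 by rewrite -ev_mulmx mxE.
have [|s sP] := @finitely_many_zeros e p.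
  apply: contraNneq l0P => p0; apply/eqP/matrixP => i j.
  by rewrite !ord1 -pE p0 pev0 mxE.
have [l1 l1P] := exists_functional (fun z (_ : z \in s) => r0 z).
by exists l0, l1 => z l0z; apply/l1P/sP; rewrite pE l0z mxE.
Qed.

Lemma mx11_eq0 (R : zmodType) (M : 'M[R]_1) : (M == 0) = (M 0 0 == 0).
Proof.
apply/eqP/eqP => [->|M0]; first by rewrite mxE.
by apply/matrixP => i j; rewrite !ord1 M0 mxE.
Qed.

(* For generic a the alternating matrices of the family do not kill a: the
   entry a0^T S a1 certifies this off finitely many parameters. *)
Lemma exists_avoiding_kernels m e (S : 'M[{poly F}]_m) :
  (forall z, ev e S z != 0) -> (forall z, (ev e S z)^T = - ev e S z) ->
  (forall z (a : 'cV_m), a^T *m ev e S z *m a = 0) ->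
  exists a : 'cV[F]_m, forall z, ev e S z *m a != 0.
Proof.
move=> S0 ST Salt.
have row_neq0 (M : 'M[F]_m) : M != 0 -> exists i, row i M != 0.
  move=> M0; apply/existsP; rewrite -negb_forall; apply: contraNN M0 => /forallP h.
  by apply/eqP/row_matrixP => i; rewrite row0; apply/eqP.
have [i0 i0P] := row_neq0 _ (S0 (Some 0)).
pose a0 : 'cV[F]_m := delta_mx i0 0.
have a0S : a0^T *m ev e S (Some 0) != 0 by rewrite /a0 trmx_delta -rowE.
have Sa0 : ev e S (Some 0) *m a0 != 0.
  rewrite -(inj_eq (@trmx_inj _ _ _)) trmx0 trmx_mul ST mulmxN oppr_eq0 //.
have [i1] := cV_neq0 Sa0; rewrite -ev_mulmxr mxE => p0i.
have [|r0 r0P] := @finitely_many_zeros e ((S *m map_mx polyC a0) i1 0).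
  by apply: contraNneq p0i => ->; rewrite pev0.
have r0P' z : ev e S z *m a0 = 0 -> z \in r0.
  by move=> Sz; apply: r0P; have /colP/(_ i1) := Sz; rewrite -ev_mulmxr !mxE.
have /choice[ix ixP] z : exists i, row i (ev e S z) != 0 by exact: row_neq0.
(* a1 must pair nontrivially with these vectors: a nonzero row of S(z) at each zero z of S a0, so
   that S(z) a1 != 0 there, and a0^T S(0), so that psi below is not identically zero. *)
pose rows z : 'cV[F]_m :=
  (if z is Some z' then row (ix z') (ev e S z') else a0^T *m ev e S (Some 0))^T.
have rows0 z : rows z != 0.
  by rewrite -(inj_eq (@trmx_inj _ _ _)) trmx0 /rows trmxK; case: z.
have [a1T a1P] := exists_functional
  (fun z (_ : z \in (None :: map Some r0)) => rows0 z).
pose a1 := a1T^T.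
have a0Sa1 : a0^T *m ev e S (Some 0) *m a1 != 0.
  rewrite -(inj_eq (@trmx_inj _ _ _)) trmx0 trmx_mul trmxK.
  by apply: (a1P None); rewrite inE.
have Sa1 z : ev e S z *m a0 = 0 -> ev e S z *m a1 != 0.
  move/r0P' => r0z; have := a1P (Some z); rewrite inE /= map_f // => /(_ isT); apply: contraNneq => Sz.
  by rewrite /rows -[a1T]trmxK -trmx_mul -row_mul Sz row0 trmx0.
pose psi := (map_mx polyC a0^T *m S *m map_mx polyC a1) 0 0.
have psiE z : pev e z psi = (a0^T *m ev e S z *m a1) 0 0.
  by rewrite -ev_mulmx -ev_mulmxr mxE.
have [|r1 r1P] := @finitely_many_zeros e psi.
  by apply: contraNneq a0Sa1 => p0; rewrite mx11_eq0 -psiE p0 pev0.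
(* Where psi is nonzero any t != 0 will do, since a0^T S a0 = 0. Each of the finitely many zeros of
   psi excludes only the roots of a nonzero polynomial in t. *)
have /choice[q qP] z : exists q : {poly F}, q != 0 /\
    forall t, q.[t] != 0 -> ev e S z *m (a0 + t *: a1) != 0.
  have [Sz|/cV_neq0[i Sz]] := eqVneq (ev e S z *m a0) 0.
    exists 'X; split; first by rewrite polyX_eq0.
    move=> t; rewrite hornerX => t0.
    by rewrite mulmxDr Sz add0r -scalemxAr scaler_eq0 negb_or t0 Sa1.
  exists (((ev e S z *m a0) i 0)%:P + ((ev e S z *m a1) i 0)%:P * 'X); split.
    apply: contraNneq Sz => /(congr1 (horner^~ 0)).
    by rewrite !hornerE => ->.
  move=> t; rewrite !hornerE; apply: contraNneq => /colP/(_ i).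
  rewrite mulmxDr -scalemxAr; move: (_ *m a0) (_ *m a1) => x y.
  by rewrite !mxE mulrC => ->.
(* The extra index [None] carries the condition t != 0. *)
pose q' z := if z is Some z' then q z' else 'X.
have [|t tP] := @exists_nonroot _ (None :: map Some r1) q'.
  by case=> [z|] /=; [case: (qP z)|rewrite polyX_eq0].
exists (a0 + t *: a1) => z.
have t0 : t != 0 by have := tP None (mem_head _ _); rewrite hornerX.
have [/r1P r1z|psi0] := eqVneq (pev e z psi) 0.
  by apply: (qP z).2; apply: (tP (Some z)); rewrite inE map_f.
apply: contraNneq psi0 => Sz.
have : a0^T *m (ev e S z *m (a0 + t *: a1)) = 0 by rewrite Sz mulmx0.
rewrite mulmxA mulmxDr Salt add0r -scalemxAr => /eqP.
by rewrite scaler_eq0 (negPf t0) /= mx11_eq0 psiE.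
Qed.

End GenericChoices.

(** * Degrees of parametrised curves and of their images *)

Section CurveDegrees.
Variable F : closedFieldType.

Definition segment k (A B : 'cV[{poly F}]_k) : 'cV[{poly {poly F}}]_k :=
  map_mx (map_poly polyC) A + 'X%:P *: map_mx (map_poly polyC) (B - A).

Lemma spec_map_polyC s (p : {poly F}) : spec s (map_poly polyC p) = p.
Proof. by apply/polyP => j; rewrite coef_spec coef_map hornerC. Qed.

Lemma spec_segment k (A B : 'cV[{poly F}]_k) s :
  map_mx (spec s) (segment A B) = A + s%:P *: (B - A).
Proof.
by apply/colP => i; rewrite !mxE rmorphD rmorphM /= !spec_map_polyC specC hornerX.
Qed.

Lemma degree_le_segment k e (A B : 'cV[{poly F}]_k) :
  degree_le e A -> degree_le e B -> degree_le e (segment A B).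
Proof.
move=> Ae Be i; rewrite !mxE.
have mapC_size (p : {poly F}) : (size p <= e.+1)%N ->
  (size (map_poly polyC p) <= e.+1)%N by apply: leq_trans (size_poly _ _).
apply: (leq_trans (size_polyD _ _)); rewrite geq_max mapC_size //=.
rewrite mul_polyC (leq_trans (size_scale_leq _ _)) // mapC_size //.
by apply: (leq_trans (size_polyD _ _)); rewrite size_polyN geq_max Ae Be.
Qed.

Section Image.
Variables (k l : nat) (X : set (proj F k)) (Y : set (proj F l)) (f : X -> Y).

(* w has degree exactly D, since ev D w None != 0. *)
Definition image_curve e (C : 'cV[{poly F}]_k) D (w : 'cV[{poly F}]_l) :=
  [/\ degree_le D w, forall z, ev D w z != 0 &
      forall z (Q : X), coords (val Q) (ev e C z) ->
        coords (val (f Q)) (ev D w z)].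

Hypothesis f_reg : regular f.

(** The fibres at s = 0 and s = 1 are nowhere zero, so they share the degree D of the family.
    Intermediate fibres may have zeros; the condition on v only concerns nonzero values. *)
Lemma image_curve_segment e (A B : 'cV[{poly F}]_k) :
  degree_le e A -> degree_le e B ->
  (forall z, ev e A z != 0) -> (forall z, ev e B z != 0) ->
  (forall s z, let v := (1 - s) *: ev e A z + s *: ev e B z in
     v != 0 -> exists Q : X, coords (val Q) v) ->
  exists D wA wB, image_curve e A D wA /\ image_curve e B D wB.
Proof.
move=> Ae Be A0 B0 AB.
have vE s z : ev e (map_mx (spec s) (segment A B)) z =
    (1 - s) *: ev e A z + s *: ev e B z.
  rewrite spec_segment evD evZ evB scalerBr scalerBl scale1r.
  by rewrite addrA addrAC.
have [|D DP] := regular_family_degree f_reg (degree_le_segment Ae Be).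
  by move=> s z; rewrite vE; apply: AB.
have [|wA [wA1 wA2 wA3]] := DP 0.
  by move=> z; rewrite vE subr0 scale1r scale0r addr0.
have [|wB [wB1 wB2 wB3]] := DP 1.
  by move=> z; rewrite vE subrr scale1r scale0r add0r.
exists D, wA, wB; split; split=> // z Q Qz.
  by apply: wA3; rewrite vE subr0 scale1r scale0r addr0.
by apply: wB3; rewrite vE subrr scale1r scale0r add0r.
Qed.

Lemma image_curve_exists e (C : 'cV[{poly F}]_k) :
  degree_le e C -> (forall z, ev e C z != 0) ->
  (forall z, exists Q : X, coords (val Q) (ev e C z)) ->
  exists D w, image_curve e C D w.
Proof.
move=> Ce C0 CX; have [|D [w [_ [wC _]]]] := image_curve_segment Ce Ce C0 C0.
  by move=> s z v _; rewrite /v -scalerDl subrK scale1r.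
by exists D, w.
Qed.

End Image.

Lemma dvdp_biggcd (I : Type) (r : seq I) (G : I -> {poly F}) p q :
  (forall i, p %| q * G i) -> p %| q * \big[@gcdp F/0]_(i <- r) G i.
Proof.
move=> pG; elim: r => [|i r IH]; first by rewrite big_nil mulr0 dvdp0.
rewrite big_cons (eqp_dvdr _ (mulp_gcdr _ _ _)) dvdp_gcd pG IH //.
Qed.

(** The columns are proportional over F[t] and the entries of each have gcd 1, so corresponding
    entries divide each other and have equal sizes. The degree is then read off at infinity, where
    both columns are nonzero. *)
Lemma same_curve_degree k D D' (w w' : 'cV[{poly F}]_k) :
  degree_le D w -> degree_le D' w' ->
  (forall z, ev D w z != 0) -> (forall z, ev D' w' z != 0) ->
  (forall t, exists P : proj F k,
     coords P (ev D w (Some t)) /\ coords P (ev D' w' (Some t))) ->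
  D = D'.
Proof.
move=> wD w'D' w0 w'0 ww'.
have prop i j : w i 0 * w' j 0 = w j 0 * w' i 0.
  apply/eqP; rewrite -subr_eq0; apply/eqP/poly_eq0_horner => t.
  have [P [Pw Pw']] := ww' t; have [c _ /colP wE] := coords_scale Pw Pw'.
  have := wE i; have := wE j; rewrite !mxE /= hornerD hornerN !hornerM => -> ->.
  by rewrite mulrCA [X in _ - X]mulrCA [_.[t] * _.[t]]mulrC subrr.
have dvd n (u v : 'cV[{poly F}]_k) : (forall z, ev n v z != 0) ->
    (forall i j, u i 0 * v j 0 = u j 0 * v i 0) -> forall i, v i 0 %| u i 0.
  move=> v0 uv i; have /(dvdp_biggcd (index_enum 'I_k)) : forall j, v i 0 %| u i 0 * v j 0.
    by move=> j; rewrite uv dvdp_mull.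
  set g := \big[_/_]_(_ <- _) _ => vug.
  have g1 : size g == 1%N.
    apply/negPn/negP => /closed_rootP[t].
    rewrite /g -[\big[_/_]_(_ <- _) _](big_map (fun j => v j 0) xpredT id) root_biggcd.
    move=> /allP gt; case/eqP: (v0 (Some t)); apply/colP => j; rewrite !mxE /=.
    by apply/eqP; rewrite -rootE gt //; apply/mapP; exists j; rewrite ?mem_index_enum.
  have [c c0 gE] : exists2 c, c != 0 & g = c%:P by apply/size_poly1P.
  by rewrite gE mulrC mul_polyC dvdpZr in vug.
have size_eq i : size (w i 0) = size (w' i 0).
  apply: eqp_size; rewrite /eqp (dvd _ _ _ w'0 prop) (dvd _ _ _ w0) // => a b.
  by rewrite mulrC -prop mulrC.
have deg_le (m n : nat) (u v : 'cV[{poly F}]_k) : degree_le n v -> (forall z, ev m u z != 0) ->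
    (forall i, size (u i 0) = size (v i 0)) -> (m <= n)%N.
  move=> vn u0 uv; have [j] := cV_neq0 (u0 None); rewrite mxE /= => uj.
  rewrite -ltnS (leq_trans _ (vn j)) // -uv ltnNge.
  by apply: contraNN uj => um; rewrite nth_default.
by apply/eqP; rewrite eqn_leq (deg_le _ _ w w') // (deg_le _ _ w' w).
Qed.

Section Covers.
Variables (k l : nat) (X : set (proj F k)) (Y : set (proj F l)) (f : X -> Y).

Definition line (M0 M1 : 'cV[F]_k) : 'cV[{poly F}]_k :=
  map_mx polyC M0 + 'X *: map_mx polyC M1.

Lemma ev_line M0 M1 z :
  ev 1 (line M0 M1) z = if z is Some t then M0 + t *: M1 else M1.
Proof.
case: z => [t|]; apply/colP => i; rewrite !mxE /=.
  by rewrite hornerD hornerM !hornerC hornerX.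
by rewrite coefD coefC coefXM coefC /= add0r.
Qed.

Lemma degree_le_line M0 M1 : degree_le 1 (line M0 M1).
Proof.
move=> i; rewrite !mxE; apply: (leq_trans (size_polyD _ _)).
rewrite geq_max (leq_trans (size_polyC_leq1 _)) //= mulrC.
by rewrite mul_polyC (leq_trans (size_scale_leq _ _)) // size_polyX.
Qed.

(** This is the parametrised line precomposed with the self-map (l0 : l1) of P^1. *)
Definition cover (l0 l1 : {poly F}) (M0 M1 : 'cV[F]_k) : 'cV[{poly F}]_k :=
  l0 *: map_mx polyC M0 + l1 *: map_mx polyC M1.

Lemma ev_cover e (l0 l1 : {poly F}) M0 M1 z :
  ev e (cover l0 l1 M0 M1) z = pev e z l0 *: M0 + pev e z l1 *: M1.
Proof.
by apply/colP => i; rewrite !mxE pevD ![_ * _%:P]mulrC !mul_polyC !pevZ ![_ * pev _ _ _]mulrC.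
Qed.

Lemma degree_le_cover e (l0 l1 : {poly F}) M0 M1 :
  (size l0 <= e.+1)%N -> (size l1 <= e.+1)%N -> degree_le e (cover l0 l1 M0 M1).
Proof.
move=> l0e l1e i; rewrite !mxE ![_ * _%:P]mulrC !mul_polyC.
apply: (leq_trans (size_polyD _ _)).
by rewrite geq_max !(leq_trans (size_scale_leq _ _)).
Qed.

Definition homogenize d (y : 'cV[{poly F}]_l) (l0 l1 : {poly F}) : 'cV[{poly F}]_l :=
  \col_i \sum_(j < d.+1) (y i 0)`_j *: (l0 ^+ (d - j) * l1 ^+ j).

Lemma ev_homogenize e d y (l0 l1 : {poly F}) z :
  (size l0 <= e.+1)%N -> (size l1 <= e.+1)%N ->
  ev (e * d) (homogenize d y l0 l1) z =
  \col_i \sum_(j < d.+1) (y i 0)`_j * (pev e z l0 ^+ (d - j) * pev e z l1 ^+ j).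
Proof.
move=> l0e l1e; apply/colP => i; rewrite !mxE pev_sum; apply: eq_bigr => j _.
rewrite pevZ; congr (_ * _).
have -> : (e * d = e * (d - j) + e * j)%N by rewrite -mulnDr subnK // -ltnS.
by rewrite pevM ?size_topX // !pevX.
Qed.

Lemma image_curve_cover e d y (l0 l1 : {poly F}) M0 M1 :
  image_curve f 1 (line M0 M1) d y ->
  (size l0 <= e.+1)%N -> (size l1 <= e.+1)%N ->
  (forall z, pev e z l0 = 0 -> pev e z l1 != 0) ->
  image_curve f e (cover l0 l1 M0 M1) (e * d) (homogenize d y l0 l1).
Proof.
move=> [yd y0 yf] l0e l1e l01.
(* z' is the point (l0(z) : l1(z)) of P^1, which is infinity when l0(z) = 0, and a is the coordinate
   used to normalise it. *)
have main z : exists z' a, [/\ a != 0,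
    ev e (cover l0 l1 M0 M1) z = a *: ev 1 (line M0 M1) z' &
    ev (e * d) (homogenize d y l0 l1) z = a ^+ d *: ev d y z'].
  rewrite ev_cover ev_homogenize //.
  have [a0|a0] := eqVneq (pev e z l0) 0.
    exists None, (pev e z l1); split; rewrite ?l01 ?ev_line ?a0 ?scale0r ?add0r //.
    apply/colP => i; rewrite !mxE big_ord_recr /= subnn expr0 mul1r big1 ?add0r.
      by rewrite mulrC.
    by move=> j _; rewrite expr0n subn_eq0 leqNgt ltn_ord mul0r mulr0.
  exists (Some (pev e z l1 / pev e z l0)), (pev e z l0); split=> //.
    by rewrite ev_line scalerDr scalerA mulrC divfK.
  apply/colP => i; rewrite !mxE /= (horner_coef_wide _ (yd i)) mulr_sumr.
  apply: eq_bigr => j _; rewrite [RHS]mulrCA; congr (_ * _).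
  have -> : pev e z l0 ^+ d = pev e z l0 ^+ (d - j) * pev e z l0 ^+ j.
    by rewrite -exprD subnK // -ltnS.
  rewrite expr_div_n -mulrA; congr (_ * _).
  by rewrite mulrC divfK // expf_neq0.
split.
- move=> i; rewrite mxE; apply: (leq_trans (size_sum _ _ _)).
  apply/bigmax_leqP => j _; apply: (leq_trans (size_scale_leq _ _)).
  have -> : (e * d = e * (d - j) + e * j)%N by rewrite -mulnDr subnK // -ltnS.
  by apply: size_topM; apply: size_topX.
- by move=> z; have [z' [a [a0 _ ->]]] := main z; rewrite scaler_eq0 negb_or expf_neq0 //=.
- move=> z Q; have [z' [a [a0 -> ->]]] := main z => Qz.
  apply: coordsZ; first exact: expf_neq0.
  apply: yf; have := coordsZ (c := a^-1) _ Qz.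
  by rewrite scalerA mulVf // scale1r; apply; rewrite invr_eq0.
Qed.

End Covers.

End CurveDegrees.

(** * Pluecker coordinates *)

Section Wedge.
Variables (F : closedFieldType) (m : nat).
Implicit Types (u v w : 'cV[F]_m) (x : 'cV[F]_(ext2dim m)).

Lemma wedgeDl u v w : wedge (u + v) w = wedge u w + wedge v w.
Proof. by apply/colP => k; rewrite !mxE !mulrDl opprD addrACA. Qed.

Lemma wedgeZl c v w : wedge (c *: v) w = c *: wedge v w.
Proof. by apply/colP => k; rewrite !mxE mulrBr !mulrA. Qed.

Lemma wedgeC v w : wedge w v = - wedge v w.
Proof. by apply/colP => k; rewrite !mxE opprB mulrC [X in _ - X]mulrC. Qed.

Lemma wedgeDr u v w : wedge w (u + v) = wedge w u + wedge w v.
Proof. by rewrite wedgeC wedgeDl opprD -!wedgeC. Qed.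

Lemma wedgeZr c v w : wedge v (c *: w) = c *: wedge v w.
Proof. by rewrite wedgeC wedgeZl -scalerN -wedgeC. Qed.

Lemma wedgevv v : wedge v v = 0.
Proof. by apply/colP => k; rewrite !mxE mulrC subrr. Qed.

Lemma wedge0v v : wedge 0 v = 0.
Proof. by rewrite -(scale0r 0) wedgeZl scale0r. Qed.

Lemma wedgev0 v : wedge v 0 = 0.
Proof. by rewrite -(scale0r 0) wedgeZr scale0r. Qed.

(** As a constant matrix, wedging with v can be applied to a polynomial curve without raising its
    degree. *)
Definition wedge_mx v : 'M[F]_(ext2dim m, m) := \matrix_(k, j)
  (v (fst_ix k) 0 *+ (snd_ix k == j) - v (snd_ix k) 0 *+ (fst_ix k == j)).

Lemma wedge_mxE v w : wedge v w = wedge_mx v *m w.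
Proof.
apply/colP => k; rewrite !mxE.
under eq_bigr do rewrite mxE mulrBl.
rewrite sumrB (bigD1 (snd_ix k)) //= eqxx mulr1n [X in _ + X - _]big1 ?addr0.
  rewrite (bigD1 (fst_ix k)) //= eqxx mulr1n [X in _ - (_ + X)]big1 ?addr0 //.
  by move=> j /negPf; rewrite eq_sym => ->; rewrite mul0r.
by move=> j /negPf; rewrite eq_sym => ->; rewrite mul0r.
Qed.

(** The signed Pluecker coordinate x_ij for arbitrary i and j, written through the alternating
    matrix E_ij - E_ji so that [wedge_formE] applies. *)
Definition alt_coef (i j : 'I_m) (k : 'I_(ext2dim m)) : F :=
  (delta_mx i j - delta_mx j i : 'M[F]_m) (fst_ix k) (snd_ix k).

Definition alt x : 'M[F]_m := \matrix_(i, j) \sum_k alt_coef i j k * x k 0.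

Lemma alt_wedge v w : alt (wedge v w) = v *m w^T - w *m v^T.
Proof.
apply/matrixP => i j; rewrite mxE wedge_formE.
- rewrite mulmxBr mulmxBl !mxE !big_ord1 !mxE.
  have deltaE (a b : 'I_m) : (v^T *m delta_mx a b *m w) 0 0 = v a 0 * w b 0.
    rewrite mxE (bigD1 b) //= big1 ?addr0 => [|c cb].
      rewrite mxE (bigD1 a) //= big1 ?addr0 => [|c ca].
        by rewrite !mxE !eqxx mulr1.
      by rewrite !mxE (negPf ca) mulr0.
    rewrite mxE big1 ?mul0r // => d _.
    by rewrite !mxE (negPf cb) andbF mulr0.
  have := deltaE i j; have := deltaE j i; rewrite !mxE => -> ->.
  by rewrite [v j 0 * _]mulrC.
- by rewrite linearB /= !trmx_delta opprB.
- by move=> k; rewrite !mxE andbC subrr.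
Qed.

Lemma alt_wedge_mul v w (a : 'cV[F]_m) :
  alt (wedge v w) *m a = (w^T *m a) 0 0 *: v - (v^T *m a) 0 0 *: w.
Proof.
rewrite alt_wedge mulmxBl -!mulmxA; congr (_ - _).
  by rewrite {1}[w^T *m a]mx11_scalar mul_mx_scalar.
by rewrite {1}[v^T *m a]mx11_scalar mul_mx_scalar.
Qed.

Lemma alt_eq0 x : alt x = 0 -> x = 0.
Proof.
move=> x0; apply/colP => k; rewrite mxE.
have /matrixP/(_ (fst_ix k) (snd_ix k)) := x0; rewrite !mxE (bigD1 k) //= big1.
  rewrite addr0 /alt_coef !mxE !eqxx /=.
  have /negPf -> : fst_ix k != snd_ix k.
    by apply: contraTneq (valP (enum_val k)); rewrite -/(fst_ix k) -/(snd_ix k) => ->; rewrite ltnn.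
  by rewrite /= subr0 mul1r.
move=> k' k'k; rewrite /alt_coef !mxE.
have lt_ix (j : 'I_(ext2dim m)) : (fst_ix j < snd_ix j)%N by exact: (valP (enum_val j)).
have /negPf -> : ~~ ((fst_ix k' == fst_ix k) && (snd_ix k' == snd_ix k)).
  apply: contraNN k'k => /andP[/eqP e1 /eqP e2].
  apply/eqP/enum_val_inj/val_inj; rewrite [LHS]surjective_pairing [RHS]surjective_pairing.
  by rewrite -/(fst_ix k) -/(snd_ix k) -/(fst_ix k') -/(snd_ix k') e1 e2.
have /negPf -> : ~~ ((fst_ix k' == snd_ix k) && (snd_ix k' == fst_ix k)).
  apply/negP => /andP[/eqP e1 /eqP e2].
  by have := lt_ix k'; rewrite e1 e2 ltnNge ltnW // lt_ix.
by rewrite subr0 mul0r.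
Qed.

Lemma wedge_eq0 v w : v != 0 -> wedge v w = 0 -> exists c, w = c *: v.
Proof.
move=> /cV_neq0[j vj] vw0; exists (w j 0 / v j 0).
have /matrixP vw : v *m w^T - w *m v^T = 0.
  by rewrite -alt_wedge vw0; apply/matrixP => a b; rewrite !mxE big1 // => k _; rewrite mxE mulr0.
apply/colP => a; have := vw a j; rewrite !mxE !big_ord1 !mxE => /eqP.
rewrite subr_eq0 => /eqP e; apply: (mulfI vj).
by rewrite mulrA [v j 0 * (_ / _)]mulrC divfK // [LHS]mulrC -e mulrC.
Qed.

Lemma wedge_neq0 v w : wedge v w != 0 -> v != 0 /\ w != 0.
Proof.
by move=> vw; split; apply: contraNneq vw => ->; rewrite ?wedge0v ?wedgev0.
Qed.

Lemma wedge_free v w a b : wedge v w != 0 -> a *: v + b *: w = 0 -> a = 0 /\ b = 0.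
Proof.
move=> vw ab; split; apply/eqP.
  have : wedge (a *: v + b *: w) w == 0 by rewrite ab wedge0v.
  by rewrite wedgeDl !wedgeZl wedgevv scaler0 addr0 scaler_eq0 (negPf vw) orbF.
have : wedge v (a *: v + b *: w) == 0 by rewrite ab wedgev0.
by rewrite wedgeDr !wedgeZr wedgevv scaler0 add0r scaler_eq0 (negPf vw) orbF.
Qed.

Lemma free_wedge v w : free [:: v; w] = (wedge v w != 0).
Proof.
rewrite free_cons span_seq1 seq1_free; apply/andP/idP => [[vw w0]|vw].
  apply: contraNneq vw => vw0; have [|c ->] := @wedge_eq0 w v w0.
    by rewrite wedgeC vw0 oppr0.
  by apply: memvZ; exact: memv_line.
have [v0 w0] := wedge_neq0 vw; split=> //; apply: contraNN vw => /vlineP[c ->].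
by rewrite wedgeZl wedgevv scaler0.
Qed.

(* u lies on the line with Pluecker vector x. *)
Definition incident u x := exists w, x = wedge u w.

Lemma incident_neq0 u x : x != 0 -> incident u x -> u != 0.
Proof. by move=> x0 [w xE]; rewrite xE in x0; have [] := wedge_neq0 x0. Qed.

Lemma incidentZl c u x : c != 0 -> incident u x -> incident (c *: u) x.
Proof.
by move=> c0 [w ->]; exists (c^-1 *: w); rewrite wedgeZl wedgeZr scalerA mulfV // scale1r.
Qed.

Lemma incidentZr c u x : incident u x -> incident u (c *: x).
Proof. by move=> [w ->]; exists (c *: w); rewrite wedgeZr. Qed.

Lemma incident_span v w u : wedge v w != 0 -> incident u (wedge v w) ->
  exists a b, u = a *: v + b *: w.
Proof.
move=> vw0 [z uz]; rewrite uz in vw0.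
have [k] := cV_neq0 vw0; set i := fst_ix k; set j := snd_ix k; rewrite !mxE => zk.
(* This functional kills u and takes on z the nonzero k-th coordinate of u /\ z. Contracting both
   sides of v /\ w = u /\ z with it isolates u. *)
pose eta : 'cV[F]_m := u i 0 *: delta_mx j 0 - u j 0 *: delta_mx i 0.
have dotE (y : 'cV[F]_m) : (y^T *m eta) 0 0 = u i 0 * y j 0 - u j 0 * y i 0.
  have dE a : (y^T *m delta_mx a (0 : 'I_1)) 0 0 = y a 0.
    by rewrite -colE !mxE.
  by rewrite mulmxBr -!scalemxAr mxE [X in X + _]mxE dE [X in _ + X]mxE [X in - X]mxE dE.
have := congr1 (fun x => alt x *m eta) uz; rewrite !alt_wedge_mul.
rewrite [in X in _ = _ - X *: _]dotE [u j 0 * _]mulrC subrr scale0r subr0 => e.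
set d := (z^T *m eta) 0 0 in e; have d0 : d != 0 by rewrite /d dotE.
exists (d^-1 * (w^T *m eta) 0 0), (- (d^-1 * (v^T *m eta) 0 0)).
by rewrite scaleNr -!scalerA -scalerBr e scalerA mulVf // scale1r.
Qed.

Lemma span_incident v w a b : wedge v w != 0 -> a *: v + b *: w != 0 ->
  incident (a *: v + b *: w) (wedge v w).
Proof.
move=> vw u0; have [a0|a0] := eqVneq a 0.
  rewrite a0 scale0r add0r in u0 *.
  have b0 : b != 0 by apply: contraNneq u0 => ->; rewrite scale0r.
  by apply: incidentZl => //; exists (- v); rewrite -scaleN1r wedgeZr scaleN1r -wedgeC.
exists (a^-1 *: w); rewrite wedgeZr wedgeDl !wedgeZl wedgevv scaler0 addr0.
by rewrite scalerA mulVf // scale1r.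
Qed.

Lemma incident_two u u' x : x != 0 -> incident u x -> incident u' x ->
  wedge u u' != 0 -> exists2 c, c != 0 & wedge u u' = c *: x.
Proof.
move=> x0 [w xE] u'x uu'; rewrite xE in x0 u'x *.
have [a [b u'E]] := incident_span x0 u'x.
have e : wedge u u' = b *: wedge u w.
  by rewrite u'E wedgeDr !wedgeZr wedgevv scaler0 add0r.
by exists b => //; apply: contraNneq uu' => b0; rewrite e b0 scale0r.
Qed.

(* If v, w, c, d were independent, the alternating matrix of the left-hand side
   would have rank 4, while that of wedge a b has rank at most 2. *)
Lemma decomposable_sum_meet v w c d a b : wedge v w != 0 -> wedge c d != 0 ->
  wedge v w + wedge c d = wedge a b ->
  exists u, [/\ u != 0, incident u (wedge v w) & incident u (wedge c d)].
Proof.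
move=> vw cd e.
pose B : 'M[F]_(m, (1 + 1) + (1 + 1)) := row_mx (row_mx v w) (row_mx c d).
(* B J B^T is the alternating matrix of the sum, and J is invertible because J^2 = -1; hence
   independent columns of B would give rank 4. *)
pose J2 : 'M[F]_(1 + 1) := block_mx 0 1%:M (- 1%:M) 0.
pose J : 'M[F]_((1 + 1) + (1 + 1)) := block_mx J2 0 0 J2.
have J2E (y z : 'cV[F]_m) : row_mx y z *m J2 *m (row_mx y z)^T = alt (wedge y z).
  rewrite mul_row_block !mulmx0 mulmxN !mulmx1 add0r addr0 tr_row_mx mul_row_col.
  by rewrite alt_wedge mulNmx addrC.
have altD x y : alt (x + y) = alt x + alt y.
  apply/matrixP => i j; rewrite !mxE -big_split; apply: eq_bigr => k _.
  by rewrite !mxE mulrDr.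
have BE : B *m J *m B^T = alt (wedge a b).
  rewrite -e altD -!J2E mul_row_block !mulmx0 add0r addr0.
  by rewrite [B^T]tr_row_mx mul_row_col.
have rank_le : (\rank (B *m J *m B^T) <= 2)%N.
  rewrite BE alt_wedge; apply: (leq_trans (mxrank_add _ _)).
  rewrite (@leq_add _ _ 1 1) // ?mxrank_opp; apply: (leq_trans (mxrankM_maxr _ _)); exact: rank_leq_row.
have J2J2 : J2 *m J2 = - 1%:M.
  rewrite mulmx_block !mul0mx !mulmx0 !mulmx1 !mul1mx !addr0 !add0r.
  by rewrite (scalar_mx_block 1 1 (1 : F)) opp_block_mx oppr0.
have : ~~ row_free B^T.
  apply: contraTN rank_le => Bfree; rewrite -ltnNge mxrankMfree //.
  rewrite -mxrank_tr trmx_mul mxrankMfree // mxrank_tr.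
  suff JJ : J *m - J = 1%:M by have := mulmx1_unit JJ => -[/mxrank_unit ->].
  rewrite mulmxN mulmx_block !mul0mx !mulmx0 !addr0 !add0r J2J2.
  by rewrite opp_block_mx !opprK !oppr0 -scalar_mx_block.
rewrite -kermx_eq0 => /rowV0Pn[kap]; rewrite sub_kermx tr_row_mx !tr_row_mx => /eqP kB k0.
rewrite -[kap]hsubmxK -[lsubmx kap]hsubmxK -[rsubmx kap]hsubmxK !mul_row_col in kB.
move: kB; set k1 := lsubmx (lsubmx kap); set k2 := rsubmx (lsubmx kap).
set k3 := lsubmx (rsubmx kap); set k4 := rsubmx (rsubmx kap) => kB.
have scE (M : 'M[F]_1) (y : 'cV[F]_m) : (M *m y^T)^T = M 0 0 *: y.
  by rewrite trmx_mul trmxK {1}[M]mx11_scalar tr_scalar_mx mul_mx_scalar.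
have := congr1 trmx kB; rewrite !linearD /= !scE trmx0 => kB'.
(* A linear relation among v, w, c, d puts this vector on both lines. *)
pose u := k1 0 0 *: v + k2 0 0 *: w.
have u' : u = (- k3 0 0) *: c + (- k4 0 0) *: d.
  by apply/eqP; rewrite -subr_eq0 /u !scaleNr opprD !opprK kB'.
have u0 : u != 0.
  apply: contraNneq k0 => u0; have [k10 k20] := wedge_free vw u0.
  rewrite u' in u0; have [/eqP k30 /eqP k40] := wedge_free cd u0.
  rewrite -[kap]hsubmxK -[lsubmx kap]hsubmxK -[rsubmx kap]hsubmxK.
  rewrite -/k1 -/k2 -/k3 -/k4 [k1]mx11_scalar [k2]mx11_scalar [k3]mx11_scalar [k4]mx11_scalar.
  rewrite !oppr_eq0 in k30 k40; rewrite k10 k20 (eqP k30) (eqP k40).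
  by rewrite !raddf0 !row_mx0.
exists u; split=> //; first exact: span_incident.
by rewrite u'; apply: span_incident; rewrite -?u'.
Qed.

Lemma exists_outside v w : (2 < m)%N -> exists u, forall a b, u <> a *: v + b *: w.
Proof.
move=> m2; have : ~~ (1%:M <= col_mx v^T w^T)%MS.
  apply: contraTN m2 => /mxrankS; rewrite mxrank1 -leqNgt => h.
  by apply: leq_trans h (rank_leq_row _).
move=> /row_subPn[i ui]; exists (row i 1%:M)^T => a b uE; case/negP: ui.
rewrite -[row i 1%:M]trmxK uE linearD !linearZ /=.
by apply: addmx_sub; apply: scalemx_sub; rewrite -addsmxE ?addsmxSl ?addsmxSr.
Qed.

End Wedge.

(** * Automorphisms map lines to lines *)

Section SymplecticForm.
Variables (F : closedFieldType) (m : nat) (A : 'M[F]_m).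
Hypothesis AT : A^T = - A.
Hypothesis A0 : forall i, A i i = 0.
Hypothesis A_unit : A \in unitmx.
Implicit Types (p q u v w : 'cV[F]_m) (x : 'cV[F]_(ext2dim m)).

Definition om v w : F := (v^T *m A *m w) 0 0.

Lemma omDl u v w : om (u + v) w = om u w + om v w.
Proof. by rewrite /om linearD !mulmxDl mxE. Qed.

Lemma omDr u v w : om w (u + v) = om w u + om w v.
Proof. by rewrite /om mulmxDr mxE. Qed.

Lemma omZl c v w : om (c *: v) w = c * om v w.
Proof. by rewrite /om linearZ /= -!scalemxAl mxE. Qed.

Lemma omZr c v w : om v (c *: w) = c * om v w.
Proof. by rewrite /om -scalemxAr mxE. Qed.

Lemma omC v w : om w v = - om v w.
Proof.
have : (w^T *m A *m v)^T = - (v^T *m A *m w).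
  by rewrite !trmx_mul trmxK AT mulNmx mulmxN mulmxA.
by move=> /matrixP/(_ 0 0); rewrite [LHS]mxE [RHS]mxE.
Qed.

Lemma omvv v : om v v = 0.
Proof. by rewrite /om -wedge_formE // big1 // => k _; rewrite wedgevv mxE mulr0. Qed.

Lemma om0v v : om 0 v = 0. Proof. by rewrite -(scale0r 0) omZl mul0r. Qed.
Lemma omv0 v : om v 0 = 0. Proof. by rewrite -(scale0r 0) omZr mul0r. Qed.

Lemma om_delta v (i : 'I_m) : om v (delta_mx i 0) = (v^T *m A) 0 i.
Proof. by rewrite /om -colE mxE. Qed.

Lemma om_nondeg v : v != 0 -> exists w, om v w != 0.
Proof.
move=> v0; have vA : (v^T *m A)^T != 0.
  apply: contraNneq v0 => vA; rewrite -[v]trmxK -[v^T](mulmxK A_unit).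
  by rewrite -[v^T *m A]trmxK vA trmx0 mul0mx trmx0.
by have [j] := cV_neq0 vA; rewrite mxE => jP; exists (delta_mx j 0); rewrite om_delta.
Qed.

Lemma om_neq0 v w : om v w != 0 -> v != 0 /\ w != 0.
Proof. by move=> vw; split; apply: contraNneq vw => ->; rewrite ?om0v ?omv0. Qed.

Definition isotropic x := x != 0 /\ exists v w, x = wedge v w /\ om v w = 0.

Local Notation X := (grassmannian F m `&` hyperplane A).

Lemma isotropicZ c x : c != 0 -> isotropic x -> isotropic (c *: x).
Proof.
move=> c0 [x0 [v [w [xE vw]]]]; rewrite xE in x0 *; split.
  by rewrite scaler_eq0 negb_or c0.
by exists (c *: v), w; rewrite wedgeZl omZl vw mulr0.
Qed.

Lemma coords_isotropic (Q : X) x : coords (val Q) x -> isotropic x.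
Proof.
move=> Qx; have := set_mem (valP Q) => -[[v [w [vw_free Qvw]]] Qh].
have [c c0 ->] := coords_scale Qvw Qx; apply: isotropicZ => //; split.
  by rewrite -free_wedge.
by exists v, w; split=> //; have := Qh _ Qvw; rewrite wedge_formE.
Qed.

Lemma isotropic_coords x : isotropic x -> exists Q : X, coords (val Q) x.
Proof.
move=> [x0 [v [w [xE vw]]]]; have [P Px] := proj_of_coords x0.
have PX : P \in X.
  apply/mem_set; split; first by exists v, w; rewrite free_wedge -xE.
  move=> y Py; have [c c0 ->] := coords_scale Px Py.
  under eq_bigr do rewrite mxE mulrCA.
  by rewrite -mulr_sumr xE wedge_formE // -/(om v w) vw mulr0.
by exists (exist _ P PX).
Qed.

Lemma isotropic_incident x u u' : isotropic x -> incident u x -> incident u' x ->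
  om u u' = 0.
Proof.
move=> [x0 [v [w [xE vw]]]]; rewrite xE in x0 *.
move=> /(incident_span x0)[a [b ->]] /(incident_span x0)[c [d ->]].
by rewrite omDl !omDr !omZl !omZr !omvv vw [om w v]omC vw oppr0 !mulr0 !addr0.
Qed.

Lemma isotropic_decomp x u : isotropic x -> incident u x ->
  exists w, x = wedge u w /\ om u w = 0.
Proof.
move=> xi ux; have [w xE] := ux; exists w; split=> //.
have [->|w0] := eqVneq w 0; first by rewrite omv0.
apply: (isotropic_incident xi ux); exists (- u).
by rewrite -scaleN1r wedgeZr scaleN1r -wedgeC.
Qed.

(** The complement of a hyperbolic plane (p, p') is nonzero and orthogonal to p, and q1 is taken
    there. A vector pairing with q1 is made orthogonal to p by adding a multiple of p', which does
    not affect its pairing with q1. *)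
Lemma exists_hyperbolic_pair p : (2 < m)%N -> p != 0 ->
  exists q1 q2, [/\ om p q1 = 0, om p q2 = 0 & om q1 q2 != 0].
Proof.
move=> m2 p0; have [p' pp'] := om_nondeg p0.
have [z zP] := exists_outside p p' m2.
pose q1 := z - (om p z / om p p') *: p' + (om p' z / om p p') *: p.
have pq1 : om p q1 = 0.
  by rewrite !omDr omZr -scaleNr omZr omvv mulr0 addr0 mulNr divfK // subrr.
have p'q1 : om p' q1 = 0.
  rewrite !omDr omZr -scaleNr omZr omvv mulr0 addr0 [om p' p]omC.
  by rewrite mulrN divfK // subrr.
have q10 : q1 != 0.
  apply/eqP => q10; apply: (zP (- (om p' z / om p p')) (om p z / om p p')).
  by apply/eqP; rewrite scaleNr addrC -subr_eq opprK -subr_eq0 addrAC -/q1 q10.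
have [y q1y] := om_nondeg q10.
exists q1, (y - (om p y / om p p') *: p'); split=> //.
  by rewrite omDr -scaleNr omZr mulNr divfK // subrr.
by rewrite omDr -scaleNr omZr [om q1 p']omC p'q1 oppr0 mulr0 addr0.
Qed.

Lemma hyperbolic_pencil p q1 q2 a b : p != 0 -> om p q1 = 0 -> om p q2 = 0 ->
  om q1 q2 != 0 -> (a != 0) || (b != 0) -> wedge p (a *: q1 + b *: q2) != 0.
Proof.
move=> p0 pq1 pq2 q12 ab; apply/eqP => /(wedge_eq0 p0)[c e].
have b0 : b = 0.
  have := congr1 (om q1) e; rewrite omDr !omZr omvv mulr0 add0r [om q1 p]omC pq1.
  by rewrite oppr0 mulr0 => /eqP; rewrite mulf_eq0 (negPf q12) orbF => /eqP.
have a0 : a = 0.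
  have := congr1 (om q2) e; rewrite omDr !omZr omvv mulr0 addr0 [om q2 p]omC pq2.
  rewrite oppr0 mulr0 [om q2 q1]omC => /eqP.
  by rewrite mulf_eq0 oppr_eq0 (negPf q12) orbF => /eqP.
by rewrite a0 b0 eqxx in ab.
Qed.

Lemma isotropic_wedge p q : om p q = 0 -> wedge p q != 0 -> isotropic (wedge p q).
Proof. by split=> //; exists p, q. Qed.

Section DegreeOne.
Variables f g : X -> X.
Hypotheses (g_reg : regular g) (fK : cancel f g).
Hypothesis m2 : (2 < m)%N.

Lemma image_curve_isotropic e C D (w : 'cV[{poly F}]_(ext2dim m)) z : (forall z, isotropic (ev e C z)) ->
  image_curve f e C D w -> isotropic (ev D w z).
Proof.
move=> Ci [_ _ wf]; have [Q Qz] := isotropic_coords (Ci z).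
exact: coords_isotropic (wf z Q Qz).
Qed.

Lemma isotropic_image_exists (h : X -> X) e (C : 'cV[{poly F}]__) :
  regular h -> degree_le e C -> (forall z, isotropic (ev e C z)) ->
  exists D (c : 'cV[{poly F}]_(ext2dim m)), image_curve h e C D c.
Proof.
move=> h_reg Ce Ci; apply: image_curve_exists => // z; first by case: (Ci z).
exact: isotropic_coords.
Qed.

Lemma image_curve_unique (h : X -> X) e C D D' (w w' : 'cV[{poly F}]_(ext2dim m)) :
  (forall z, isotropic (ev e C z)) ->
  image_curve h e C D w -> image_curve h e C D' w' -> D = D'.
Proof.
move=> Ci [wD w0 wh] [w'D w'0 w'h]; apply: same_curve_degree wD w'D w0 w'0 _ => t.
have [Q Qt] := isotropic_coords (Ci (Some t)); exists (val (h Q)).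
by split; [apply: wh|apply: w'h].
Qed.

Lemma isotropic_segment (h : X -> X) e (C C' : 'cV[{poly F}]__) :
  regular h -> degree_le e C -> degree_le e C' ->
  (forall a b z, let v := a *: ev e C z + b *: ev e C' z in
     v != 0 -> isotropic v) ->
  (forall z, ev e C z != 0) -> (forall z, ev e C' z != 0) ->
  exists D wA wB, image_curve h e C D wA /\ image_curve h e C' D wB.
Proof.
move=> h_reg Ce C'e CC' C0 C'0; apply: image_curve_segment => // s z v v0.
by apply: isotropic_coords; apply: CC'.
Qed.

(** The interior product of x with om(-, p); it vanishes when the whole line is orthogonal to p. *)
Definition contract p x := alt x *m (A *m p).

Lemma contractE p v w : contract p (wedge v w) = om w p *: v - om v p *: w.
Proof. by rewrite /contract alt_wedge_mul !mulmxA. Qed.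

Lemma om_contract p v w : om p (contract p (wedge v w)) = 0.
Proof.
rewrite contractE omDr -scaleNr !omZr [om p v]omC [om p w]omC mulrN mulrNN mulrC.
by rewrite addNr.
Qed.

(** Otherwise p would lie on the isotropic line x, hence be orthogonal to all of it, and the
    contraction would be zero. *)
Lemma wedge_contract_neq0 p x : isotropic x -> contract p x != 0 ->
  wedge p (contract p x) != 0.
Proof.
move=> xi r0; have [x0 [v [w [xE vw]]]] := xi; rewrite xE contractE in r0 *.
rewrite xE in x0 xi.
have p0 : p != 0 by apply: contraNneq r0 => ->; rewrite !omv0 !scale0r subr0.
apply/eqP => /(wedge_eq0 p0)[c e]; move: (r0); rewrite e => cp0.
have px : incident p (wedge v w).
  have c0 : c != 0 by apply: contraNneq cp0 => ->; rewrite scale0r.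
  have -> : p = c^-1 *: (om w p *: v - om v p *: w) by rewrite e scalerA mulVf ?scale1r.
  apply: incidentZl; first by rewrite invr_eq0.
  by rewrite -scaleNr; apply: span_incident => //; rewrite scaleNr.
have vx : incident v (wedge v w) by exists w.
have wx : incident w (wedge v w).
  by exists (- v); rewrite -scaleN1r wedgeZr scaleN1r -wedgeC.
case/eqP: r0; rewrite (isotropic_incident xi vx px) (isotropic_incident xi wx px).
by rewrite !scale0r subr0.
Qed.

(* The segment from x to p /\ contract p x is, up to scalars, the orbit of x
   under the transvections v |-> v + s om(v, p) p. *)
Lemma isotropic_transvection p x a b : isotropic x ->
  let y := a *: x + b *: wedge p (contract p x) in y != 0 -> isotropic y.
Proof.
move=> [x0 [v [w [xE vw]]]] y; rewrite /y {y}.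
have [->|a0] := eqVneq a 0.
  rewrite scale0r add0r => y0; apply: isotropicZ.
    by apply: contraNneq y0 => ->; rewrite scale0r.
  apply: isotropic_wedge; first by rewrite xE om_contract.
  by apply: contraNneq y0 => ->; rewrite scaler0.
move=> y0; split=> //; rewrite xE contractE.
(* The transvection with parameter s changes x by -s p /\ [contract p x], whence s = -b/a. The case
   a = 0, the limit of the orbit, was treated above. *)
pose s := - (b / a); exists (a *: (v + (s * om v p) *: p)), (w + (s * om w p) *: p).
split; last first.
  by rewrite omZl omDl !omDr !omZl !omZr vw omvv [om p w]omC; ring.
rewrite -scaleNr wedgeZl wedgeDl !wedgeDr !wedgeZl !wedgeZr wedgevv [wedge v p]wedgeC.
move: (wedge v w) (wedge p v) (wedge p w) => x1 x2 x3.
by apply/colP => k; rewrite !mxE /s; field.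
Qed.

Definition alt_poly (C : 'cV[{poly F}]_(ext2dim m)) : 'M[{poly F}]_m :=
  \matrix_(i, j) \sum_k (alt_coef F i j k)%:P * C k 0.

Lemma ev_alt_poly e C z : ev e (alt_poly C) z = alt (ev e C z).
Proof.
apply/matrixP => i j; rewrite !mxE pev_sum; apply: eq_bigr => k _.
by rewrite mul_polyC pevZ mxE.
Qed.

Lemma degree_le_alt_poly e C (a : 'cV[F]_m) : degree_le e C ->
  degree_le e (alt_poly C *m map_mx polyC a).
Proof.
move=> Ce i; rewrite mxE; apply: (leq_trans (size_sum _ _ _)).
apply/bigmax_leqP => j _; rewrite !mxE mulrC mul_polyC.
apply: (leq_trans (size_scale_leq _ _)); apply: (leq_trans (size_sum _ _ _)).
by apply/bigmax_leqP => k _; rewrite mul_polyC (leq_trans (size_scale_leq _ _)).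
Qed.

(* Let C be the image of the line, of degree e. Deform C to R = p /\ r, where
   r(t) is the point of C(t) orthogonal to p, and then, inside the projective
   space of isotropic lines through p, to an e-fold cover B of a line. The image
   under g keeps its degree: it is 1 for C and a multiple of e for B. *)
Lemma line_image_degree M0 M1 e (w : 'cV[{poly F}]_(ext2dim m)) :
  (forall z, isotropic (ev 1 (line M0 M1) z)) ->
  image_curve f 1 (line M0 M1) e w -> e = 1%N.
Proof.
move=> Mi wI; have [we w0 wf] := wI.
have wi z : isotropic (ev e w z) by apply: image_curve_isotropic wI.
have alt_alt v v' (a : 'cV[F]_m) : a^T *m alt (wedge v v') *m a = 0.
  rewrite -mulmxA alt_wedge_mul mulmxBr -!scalemxAr; apply/eqP.
  rewrite mx11_eq0 !mxE; apply/eqP.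
  have sym (y : 'cV[F]_m) : (y^T *m a) 0 0 = (a^T *m y) 0 0.
    have /matrixP/(_ 0 0) : (y^T *m a)^T = a^T *m y by rewrite trmx_mul trmxK.
    by rewrite [LHS]mxE.
  have := sym v; have := sym v'; rewrite !mxE => -> ->.
  by rewrite mulrC subrr.
have [|||a aP] := @exists_avoiding_kernels _ _ e (alt_poly w).
- move=> z; rewrite ev_alt_poly; apply/eqP => /alt_eq0; exact/eqP.
- move=> z; rewrite ev_alt_poly; have [_ [v [v' [-> _]]]] := wi z.
  by rewrite alt_wedge linearB /= !trmx_mul !trmxK opprB.
- by move=> z b; rewrite ev_alt_poly; have [_ [v [v' [-> _]]]] := wi z.
(* With A p = a, contracting the curve with p is multiplying its matrix by a, which never gives
   zero. *)
pose p := invmx A *m a; pose r : 'cV_m := alt_poly w *m map_mx polyC a.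
have rE z : ev e r z = contract p (ev e w z).
  by rewrite ev_mulmxr ev_alt_poly /contract /p mulKVmx.
have r0 z : contract p (ev e w z) != 0 by rewrite -rE ev_mulmxr.
have re : degree_le e r by apply: degree_le_alt_poly.
have p0 : p != 0.
  by apply: contraNneq (r0 None) => ->; rewrite /contract !mulmx0.
have pr z : om p (ev e r z) = 0.
  by rewrite rE; have [_ [v [v' [-> _]]]] := wi z; exact: om_contract.
pose R : 'cV_(ext2dim m) := map_mx polyC (wedge_mx p) *m r.
have RE z : ev e R z = wedge p (ev e r z) by rewrite ev_mulmx wedge_mxE.
have Re : degree_le e R by apply: degree_le_mulmx.
have R0 z : ev e R z != 0 by rewrite RE rE wedge_contract_neq0.
have Ri z : isotropic (ev e R z).
  by rewrite RE; apply: isotropic_wedge; rewrite -?RE.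
have [|D1 [gw [gR [gwI gRI]]]] := isotropic_segment g_reg we Re _ w0 R0.
  by move=> b c z v; rewrite /v RE rE; apply: isotropic_transvection.
(* g undoes f, so the image of w under g is the original line. *)
have D11 : D1 = 1%N.
  have [gwD gw0 gwg] := gwI.
  apply: same_curve_degree gwD (degree_le_line M0 M1) gw0 _ _.
    by move=> z; case: (Mi z).
  move=> t; have [Q Qt] := isotropic_coords (Mi (Some t)); exists (val Q); split=> //.
  by rewrite -[Q]fK; apply: gwg; apply: wf.
have [q1 [q2 [pq1 pq2 q12]]] := exists_hyperbolic_pair m2 p0.
have [l0 [l1 l01]] := exists_two_functionals (r := r) (fun z => eq_ind_r (fun y => y != 0) (r0 z) (rE z)).
pose h0 := (map_mx polyC l0 *m r) 0 0; pose h1 := (map_mx polyC l1 *m r) 0 0.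
have hE l z : pev e z ((map_mx polyC l *m r) 0 0) = (l *m ev e r z) 0 0.
  by rewrite -ev_mulmx [RHS]mxE.
have h0e : (size h0 <= e.+1)%N by apply: degree_le_mulmx.
have h1e : (size h1 <= e.+1)%N by apply: degree_le_mulmx.
have h01 z : pev e z h0 = 0 -> pev e z h1 != 0.
  rewrite !hE => /eqP; rewrite -mx11_eq0 => /eqP/l01; by rewrite mx11_eq0.
(* Every combination of R and B is p wedged with a vector orthogonal to p, so the pencil joining
   them stays isotropic. *)
pose B := cover h0 h1 (wedge p q1) (wedge p q2).
have BE z : ev e B z = wedge p (pev e z h0 *: q1 + pev e z h1 *: q2).
  by rewrite ev_cover wedgeDr !wedgeZr.
have Be : degree_le e B by apply: degree_le_cover.
have B0 z : ev e B z != 0.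
  rewrite BE; apply: hyperbolic_pencil => //.
  by have [/h01 ->|] := eqVneq (pev e z h0) 0; rewrite ?orbT.
have [|D2 [gR' [gB [gR'I gBI]]]] := isotropic_segment g_reg Re Be _ R0 B0.
  move=> b c z v; rewrite /v RE BE -!wedgeZr -wedgeDr => v0.
  apply: isotropic_wedge => //.
  by rewrite omDr !omZr omDr !omZr pr pq1 pq2 !mulr0 addr0 mulr0 addr0.
have D12 : D1 = D2 by apply: image_curve_unique Ri gRI gR'I.
have Li z : isotropic (ev 1 (line (wedge p q1) (wedge p q2)) z).
  rewrite ev_line; case: z => [t|]; last first.
    apply: isotropic_wedge => //.
    by have := @hyperbolic_pencil p q1 q2 0 1 p0 pq1 pq2 q12; rewrite scale0r add0r scale1r oner_neq0 orbT => ->.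
  rewrite -wedgeZr -wedgeDr; apply: isotropic_wedge.
    by rewrite omDr omZr pq1 pq2 mulr0 addr0.
  by have := @hyperbolic_pencil p q1 q2 1 t p0 pq1 pq2 q12; rewrite scale1r oner_neq0 => ->.
have [d [y yI]] := isotropic_image_exists g_reg (degree_le_line _ _) Li.
have := image_curve_cover yI h0e h1e h01 => hI.
have Bi z : isotropic (ev e B z).
  rewrite BE; apply: isotropic_wedge; last by rewrite -BE.
  by rewrite omDr !omZr pq1 pq2 !mulr0 addr0.
have := image_curve_unique Bi gBI hI; rewrite -D12 D11 => /esym/eqP.
by rewrite muln_eq1 => /andP[/eqP].
Qed.

End DegreeOne.
End SymplecticForm.

(** * The induced map on points *)

Section PointMap.
Variables (F : closedFieldType) (m : nat) (A : 'M[F]_m).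
Hypothesis AT : A^T = - A.
Hypothesis A0 : forall i, A i i = 0.
Hypothesis A_unit : A \in unitmx.
Hypothesis m2 : (2 < m)%N.
Implicit Types (p q u v w e : 'cV[F]_m) (x y : 'cV[F]_(ext2dim m)).

Local Notation X := (grassmannian F m `&` hyperplane A).
Local Notation om := (om A).
Implicit Types (M N P Q : X).

Definition through u Q := exists x, coords (val Q) x /\ incident u x.

Lemma through_coords u Q x : coords (val Q) x -> through u Q -> incident u x.
Proof.
move=> Qx [y [Qy uy]]; have [c c0 ->] := coords_scale Qy Qx; exact: incidentZr.
Qed.

Lemma through_neq0 u Q : through u Q -> u != 0.
Proof. by move=> [x [Qx ux]]; apply: incident_neq0 ux; exact: coords_ne0 Qx. Qed.

Lemma throughZ c u Q : c != 0 -> through u Q -> through (c *: u) Q.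
Proof. by move=> c0 [x [Qx ux]]; exists x; split=> //; apply: incidentZl. Qed.

Lemma through_orth u v Q : through u Q -> through v Q -> om u v = 0.
Proof.
move=> [x [Qx ux]] /(through_coords Qx) vx.
exact: isotropic_incident (coords_isotropic AT A0 Qx) ux vx.
Qed.

Lemma through_wedge u v Q : coords (val Q) (wedge u v) -> through u Q /\ through v Q.
Proof.
move=> Quv; split; exists (wedge u v); split=> //; first by exists v.
by exists (- u); rewrite -scaleN1r wedgeZr scaleN1r -wedgeC.
Qed.

Lemma through_span u v z Q : coords (val Q) (wedge u v) -> through z Q ->
  exists a b, z = a *: u + b *: v.
Proof.
move=> Quv /(through_coords Quv); apply: incident_span; exact: coords_ne0 Quv.
Qed.

Lemma through_two u v Q : wedge u v != 0 -> through u Q -> through v Q ->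
  coords (val Q) (wedge u v).
Proof.
move=> uv [x [Qx ux]] /(through_coords Qx) vx.
have [c c0 ->] := incident_two (coords_ne0 Qx) ux vx uv; exact: coordsZ.
Qed.

Lemma isotropic_line u v : om u v = 0 -> wedge u v != 0 ->
  exists Q, coords (val Q) (wedge u v).
Proof. by move=> uv0 uv; apply: (isotropic_coords AT A0); apply: isotropic_wedge. Qed.

Lemma exists_through Q u : through u Q ->
  exists v, coords (val Q) (wedge u v) /\ om u v = 0.
Proof.
move=> [x [Qx ux]]; have [v [xE uv]] := isotropic_decomp AT A0 (coords_isotropic AT A0 Qx) ux.
by exists v; rewrite -xE.
Qed.

Definition meets P Q := exists u, through u P /\ through u Q.

Lemma X_eq P Q x c : coords (val P) x -> coords (val Q) (c *: x) -> P = Q.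
Proof.
move=> Px Qcx; have c0 : c != 0.
  by apply: contraNneq (coords_ne0 Qcx) => ->; rewrite scale0r.
by apply: val_inj; apply: coords_inj Qcx; apply: coordsZ.
Qed.

Lemma meets_self P : meets P P.
Proof.
have [x Px] := coords_exists (val P).
have [_ [v [w [xE _]]]] := coords_isotropic AT A0 Px.
by exists v; split; exists x; split=> //; exists w.
Qed.

Lemma meets_sum P Q x y : coords (val P) x -> coords (val Q) y ->
  isotropic A (x + y) -> meets P Q.
Proof.
move=> Px Qy [_ [a [b [e _]]]].
have [x0 [v [w [xE _]]]] := coords_isotropic AT A0 Px.
have [y0 [v' [w' [yE _]]]] := coords_isotropic AT A0 Qy.
rewrite xE in Px x0 e; rewrite yE in Qy y0 e.
have [u [u0 ux uy]] := decomposable_sum_meet x0 y0 e.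
by exists u; split; [exists (wedge v w)|exists (wedge v' w')].
Qed.

(* Two lines through p spanning a non-isotropic plane: their common neighbours
   are then exactly the isotropic lines through p, which is how a point is
   recovered from incidences of lines. *)
Definition hyperbolic P Q := [/\ P <> Q, meets P Q &
  forall M N, meets M P -> meets M Q -> meets N P -> meets N Q -> meets M N].

(** N contains some a p + b q1 and some c p + d q2. Their orthogonality reads b d om(q1, q2) = 0, so
    one of them is a multiple of p. *)
Lemma common_neighbour_through p q1 q2 P Q N :
  om p q1 = 0 -> om p q2 = 0 -> om q1 q2 != 0 ->
  coords (val P) (wedge p q1) -> coords (val Q) (wedge p q2) ->
  meets N P -> meets N Q -> through p N.
Proof.
move=> pq1 pq2 q12 Pc Qc [u1 [u1N u1P]] [u2 [u2N u2Q]].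
have [a [b u1E]] := through_span Pc u1P; have [c [d u2E]] := through_span Qc u2Q.
have sc k v : through v N -> v = k *: p -> through p N.
  move=> vN vE; have v0 := through_neq0 vN.
  have k0 : k != 0 by apply: contraNneq v0 => k0; rewrite vE k0 scale0r.
  by have := throughZ (c := k^-1) _ vN; rewrite vE scalerA mulVf // scale1r; apply; rewrite invr_eq0.
have [b0|b0] := eqVneq b 0.
  by apply: (sc a _ u1N); rewrite u1E b0 scale0r addr0.
have [d0|d0] := eqVneq d 0.
  by apply: (sc c _ u2N); rewrite u2E d0 scale0r addr0.
have := through_orth u1N u2N; rewrite u1E u2E omDl !omDr !omZl !omZr (omvv AT A0).
rewrite pq2 (omC AT p q1) pq1 oppr0 !mulr0 !add0r => /eqP.
by rewrite !mulf_eq0 (negPf b0) (negPf d0) (negPf q12).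
Qed.

Lemma hyperbolic_of p q1 q2 P Q : om p q1 = 0 -> om p q2 = 0 -> om q1 q2 != 0 ->
  coords (val P) (wedge p q1) -> coords (val Q) (wedge p q2) -> hyperbolic P Q.
Proof.
move=> pq1 pq2 q12 Pc Qc.
have [p0 _] := wedge_neq0 (coords_ne0 Pc).
have [pP _] := through_wedge Pc; have [pQ _] := through_wedge Qc.
split; last 1 first.
- move=> M N MP MQ NP NQ; exists p.
  by split; apply: (common_neighbour_through pq1 pq2 q12 Pc Qc).
- move=> PQ; rewrite -PQ in Qc; have [c c0 e] := coords_scale Pc Qc.
  have := @hyperbolic_pencil _ _ A AT A0 p q1 q2 (- c) 1 p0 pq1 pq2 q12.
  rewrite oner_neq0 orbT => /(_ isT).
  by rewrite wedgeDr !wedgeZr scale1r e scaleNr addNr eqxx.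
- by exists p.
Qed.

Lemma om_separate p q : wedge p q != 0 -> exists z, om p z = 0 /\ om q z != 0.
Proof.
move=> pq; have [p0 _] := wedge_neq0 pq.
have [z1 pz1] := om_nondeg A_unit p0.
have qp0 : q - (om q z1 / om p z1) *: p != 0.
  apply: contraNneq pq => /eqP; rewrite subr_eq0 => /eqP ->.
  by rewrite wedgeZr wedgevv scaler0.
have [y yP] := om_nondeg A_unit qp0.
exists (y - (om p y / om p z1) *: z1); split.
  by rewrite omDr -scaleNr omZr mulNr divfK // subrr.
apply: contraNneq yP; rewrite omDr -scaleNr omZr omDl -scaleNr omZl => e.
by rewrite -[X in _ == X]e; apply/eqP; field.
Qed.

(** If q1 and q2 were orthogonal, K = q1 /\ q2 and M = p /\ z, with z orthogonal to p but not to q1,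
    would both meet P and Q. A common point of K and M would be a multiple of p, forcing P = Q. *)
Lemma hyperbolic_inv P Q : hyperbolic P Q -> exists p q1 q2,
  [/\ om p q1 = 0, om p q2 = 0, om q1 q2 != 0, coords (val P) (wedge p q1) &
      coords (val Q) (wedge p q2)].
Proof.
move=> [PQ [p [pP pQ]] clique].
have [q1 [Pc pq1]] := exists_through pP; have [q2 [Qc pq2]] := exists_through pQ.
exists p, q1, q2; split=> //; apply/eqP => q12.
have x0 := coords_ne0 Pc; have [p0 q10] := wedge_neq0 x0.
have q12w : wedge q1 q2 != 0.
  apply/eqP => /(wedge_eq0 q10)[c q2E]; apply: PQ; apply: (X_eq (c := c) Pc).
  by rewrite -wedgeZr -q2E.
have [z [pz q1z]] := om_separate x0.
have pzw : wedge p z != 0.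
  apply/eqP => /(wedge_eq0 p0)[c zE].
  by rewrite zE omZr (omC AT) pq1 oppr0 mulr0 eqxx in q1z.
have [K Kc] := isotropic_line q12 q12w; have [M Mc] := isotropic_line pz pzw.
have [q1K q2K] := through_wedge Kc; have [pM _] := through_wedge Mc.
have [_ q1P] := through_wedge Pc; have [_ q2Q] := through_wedge Qc.
have [u [uK uM]] : meets K M.
  by apply: clique; [exists q1|exists q2|exists p|exists p].
have u0 := through_neq0 uK.
have [a [b uE]] := through_span Kc uK; have [c [d uE']] := through_span Mc uM.
have d0 : d = 0.
  have := congr1 (om q1) uE; rewrite uE' !omDr !omZr (omvv AT A0) q12 (omC AT p q1) pq1.
  rewrite oppr0 !mulr0 add0r addr0 => /eqP.
  by rewrite mulf_eq0 (negPf q1z) orbF => /eqP.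
rewrite d0 scale0r addr0 in uE'.
have e : a *: wedge p q1 + b *: wedge p q2 = 0.
  by rewrite -!wedgeZr -wedgeDr -uE uE' wedgeZr wedgevv scaler0.
have b0 : b != 0.
  apply: contraNneq u0 => b0; rewrite b0 scale0r addr0 in e; rewrite b0 scale0r addr0 in uE.
  move/eqP: e; rewrite scaler_eq0 (negPf x0) orbF => /eqP a0.
  by rewrite uE a0 scale0r.
apply: PQ; apply: (X_eq (c := - (a / b)) Pc).
have -> : - (a / b) *: wedge p q1 = wedge p q2; last exact: Qc.
apply: (scalerI b0); apply/eqP; rewrite -subr_eq0 scalerA mulrN mulrCA mulfV // mulr1.
by rewrite scaleNr -opprD e oppr0.
Qed.

(** Two isotropic lines p /\ q1 and p /\ q2 with om(q1, q2) != 0 already meet only in p. *)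
Lemma line_through_unique p (y : 'cV[F]_m) : p != 0 ->
  (forall N, through p N -> through y N) -> exists2 c, c != 0 & y = c *: p.
Proof.
move=> p0 py; have [q1 [q2 [pq1 pq2 q12]]] := exists_hyperbolic_pair AT A0 A_unit m2 p0.
have w1 : wedge p q1 != 0.
  have := @hyperbolic_pencil _ _ A AT A0 p q1 q2 1 0 p0 pq1 pq2 q12.
  by rewrite oner_neq0 scale1r scale0r addr0; apply.
have w2 : wedge p q2 != 0.
  have := @hyperbolic_pencil _ _ A AT A0 p q1 q2 0 1 p0 pq1 pq2 q12.
  by rewrite oner_neq0 orbT scale1r scale0r add0r; apply.
have [P Pc] := isotropic_line pq1 w1; have [Q Qc] := isotropic_line pq2 w2.
have yP := py _ (through_wedge Pc).1; have yQ := py _ (through_wedge Qc).1.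
have y0 := through_neq0 yP.
have [a [b yE]] := through_span Pc yP; have [c [d yE']] := through_span Qc yQ.
have d0 : d = 0.
  have := congr1 (om q1) yE; rewrite yE' !omDr !omZr (omvv AT A0) (omC AT p q1) pq1.
  rewrite oppr0 !mulr0 !add0r => /eqP.
  by rewrite mulf_eq0 (negPf q12) orbF => /eqP.
rewrite d0 scale0r addr0 in yE'; exists c => //.
by apply: contraNneq y0 => c0; rewrite yE' c0 scale0r.
Qed.

(** tau chooses a vector for each image point, so its values matter only up to a scalar. *)
Definition induces (f : X -> X) (tau : 'cV[F]_m -> 'cV[F]_m) :=
  forall p, p != 0 -> tau p != 0 /\ forall N, through p N -> through (tau p) (f N).

Lemma line_image (f g : X -> X) (M0 M1 : 'cV[F]_(ext2dim m)) : regular f -> regular g -> cancel f g ->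
  (forall z, isotropic A (ev 1 (line M0 M1) z)) ->
  exists w0 w1 : 'cV[F]_(ext2dim m), (forall t Q, coords (val Q) (M0 + t *: M1) ->
     coords (val (f Q)) (w0 + t *: w1)) /\
   forall Q, coords (val Q) M1 -> coords (val (f Q)) w1.
Proof.
move=> f_reg g_reg fK Mi.
have [e [c cI]] := isotropic_image_exists AT A0 f_reg (degree_le_line M0 M1) Mi.
have e1 := line_image_degree AT A0 A_unit g_reg fK m2 Mi cI.
rewrite e1 in cI; have [c1 _ cf] := cI.
exists (\col_i (c i 0)`_0), (\col_i (c i 0)`_1); split=> [t Q|Q] Qc.
  have := cf (Some t) Q; rewrite ev_line => /(_ Qc); congr coords.
  apply/colP => i; rewrite !mxE /= (horner_coef_wide _ (c1 i)).
  by rewrite big_ord_recl big_ord1 expr0 mulr1 expr1 mulrC.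
have := cf None Q; rewrite ev_line => /(_ Qc); congr coords.
by apply/colP => i; rewrite !mxE.
Qed.

(** P and Q span a line of X. On its image w0 + t w1 the value at t = 1 is decomposable, so
    [meets_sum] applies to the two end points. *)
Lemma meets_image (f g : X -> X) P Q : regular f -> regular g -> cancel f g ->
  meets P Q -> meets (f P) (f Q).
Proof.
move=> f_reg g_reg fK [u [uP uQ]].
have [->|PQ] := pselect (P = Q); first exact: meets_self.
have [v [Pc uv]] := exists_through uP; have [w [Qc uw]] := exists_through uQ.
have sum0 t : wedge u (v + t *: w) != 0.
  apply/eqP; rewrite wedgeDr wedgeZr => /eqP; rewrite addr_eq0 -scaleNr => /eqP e.
  by apply: PQ; apply/esym; apply: (X_eq (c := - t) Qc); rewrite -e.
have Mi z : isotropic A (ev 1 (line (wedge u v) (wedge u w)) z).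
  rewrite ev_line; case: z => [t|].
    rewrite -wedgeZr -wedgeDr; apply: isotropic_wedge => //.
    by rewrite omDr omZr uv uw mulr0 addr0.
  by apply: isotropic_wedge => //; exact: coords_ne0 Qc.
have [w0 [w1 [w01 wQ]]] := line_image f_reg g_reg fK Mi.
have [S Sc] := isotropic_coords AT A0 (Mi (Some 1)).
rewrite ev_line in Sc; have := coords_isotropic AT A0 (w01 1 S Sc).
rewrite scale1r; apply: meets_sum (wQ _ Qc).
by have := w01 0 P; rewrite !scale0r !addr0; apply.
Qed.

Section Automorphism.
Variables f g : X -> X.
Hypotheses (f_reg : regular f) (g_reg : regular g).
Hypotheses (fK : cancel f g) (gK : cancel g f).

Lemma hyperbolic_image P Q : hyperbolic P Q -> hyperbolic (f P) (f Q).
Proof.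
move=> [PQ PmQ clique]; split.
- by move=> e; apply: PQ; rewrite -[P]fK e fK.
- exact: meets_image g_reg fK PmQ.
- move=> M N MP MQ NP NQ; rewrite -[M]gK -[N]gK.
  apply: (meets_image f_reg g_reg fK).
  by apply: clique; [rewrite -[P]fK|rewrite -[Q]fK|rewrite -[P]fK|rewrite -[Q]fK];
    apply: (meets_image g_reg f_reg gK).
Qed.

(** A hyperbolic pair of lines through p goes to such a pair through some p'. A line through p meets
    both, so its image meets both images and passes through p'. *)
Lemma induces_exists : exists tau, induces f tau.
Proof.
suff /choice[tau tauP] : forall p, exists p', p != 0 ->
    p' != 0 /\ forall N, through p N -> through p' (f N) by exists tau.
move=> p; have [->|p0] := eqVneq p 0; first by exists 0.
have [q1 [q2 [pq1 pq2 q12]]] := exists_hyperbolic_pair AT A0 A_unit m2 p0.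
have w1 : wedge p q1 != 0.
  have := @hyperbolic_pencil _ _ A AT A0 p q1 q2 1 0 p0 pq1 pq2 q12.
  by rewrite oner_neq0 scale1r scale0r addr0; apply.
have w2 : wedge p q2 != 0.
  have := @hyperbolic_pencil _ _ A AT A0 p q1 q2 0 1 p0 pq1 pq2 q12.
  by rewrite oner_neq0 orbT scale1r scale0r add0r; apply.
have [P Pc] := isotropic_line pq1 w1; have [Q Qc] := isotropic_line pq2 w2.
have [p' [q1' [q2' [pq1' pq2' q12' Pc' Qc']]]] :=
  hyperbolic_inv (hyperbolic_image (hyperbolic_of pq1 pq2 q12 Pc Qc)).
exists p' => _; split; first exact: (wedge_neq0 (coords_ne0 Pc')).1.
move=> N pN; apply: (common_neighbour_through pq1' pq2' q12' Pc' Qc');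
  apply: (meets_image f_reg g_reg fK); exists p; split=> //.
  exact: (through_wedge Pc).1.
exact: (through_wedge Qc).1.
Qed.

Variables tau sigma : 'cV[F]_m -> 'cV[F]_m.
Hypotheses (tauP : induces f tau) (sigmaP : induces g sigma).

Lemma tau_unique p (y : 'cV[F]_m) : p != 0 -> (forall N, through p N -> through y (f N)) ->
  exists2 c, c != 0 & y = c *: tau p.
Proof.
move=> p0 py; have [tp0 tp] := tauP p0; apply: line_through_unique => // N tpN.
rewrite -[N]gK; apply: py.
have [_ /(_ _ tpN)] := sigmaP tp0.
have [c c0 ->] : exists2 c, c != 0 & sigma (tau p) = c *: p; last first.
  by move/(throughZ (c := c^-1)); rewrite scalerA mulVf // scale1r; apply; rewrite invr_eq0.
apply: line_through_unique => // M pM; rewrite -[M]fK.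
by have [_] := sigmaP tp0; apply; apply: tp.
Qed.

Lemma sigma_tau p : p != 0 -> exists2 c, c != 0 & sigma (tau p) = c *: p.
Proof.
move=> p0; have [tp0 tp] := tauP p0; apply: line_through_unique => // M pM.
by rewrite -[M]fK; have [_] := sigmaP tp0; apply; apply: tp.
Qed.

Lemma tau_orth p q : p != 0 -> q != 0 -> om p q = 0 -> om (tau p) (tau q) = 0.
Proof.
move=> p0 q0 pq; have [tp0 tp] := tauP p0; have [tq0 tq] := tauP q0.
have [/(wedge_eq0 p0)[c qE]|pqw] := eqVneq (wedge p q) 0.
  have [d _ ->] : exists2 d, d != 0 & tau q = d *: tau p.
    apply: tau_unique => // N pN; apply: tq; rewrite qE; apply: throughZ pN.
    by apply: contraNneq q0 => c0; rewrite qE c0 scale0r.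
  by rewrite omZr omvv ?mulr0.
have [N Nc] := isotropic_line pq pqw; have [pN qN] := through_wedge Nc.
exact: through_orth (tp _ pN) (tq _ qN).
Qed.

End Automorphism.

Lemma exists_orth u e z : om u e != 0 -> exists a b,
  om u (z - a *: u - b *: e) = 0 /\ om (z - a *: u - b *: e) e = 0.
Proof.
move=> ue; exists (om z e / om u e), (om u z / om u e).
rewrite -!scaleNr !omDr !omZr !omDl !omZl !omvv //; split; field => //.
Qed.

Section Projectivity.
Variables f g : X -> X.
Hypotheses (f_reg : regular f) (g_reg : regular g).
Hypotheses (fK : cancel f g) (gK : cancel g f).
Variables tau sigma : 'cV[F]_m -> 'cV[F]_m.
Hypotheses (tauP : induces f tau) (sigmaP : induces g sigma).

Lemma tau_orthE p q : p != 0 -> q != 0 -> (om (tau p) (tau q) == 0) = (om p q == 0).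
Proof.
move=> p0 q0; apply/eqP/eqP; last exact: (tau_orth fK gK tauP sigmaP).
have [tp0 _] := tauP p0; have [tq0 _] := tauP q0.
move=> /(tau_orth gK fK sigmaP tauP tp0 tq0).
have [c c0 ->] := sigma_tau fK tauP sigmaP p0.
have [d d0 ->] := sigma_tau fK tauP sigmaP q0.
by rewrite omZl omZr => /eqP; rewrite !mulf_eq0 (negPf c0) (negPf d0) => /eqP.
Qed.

(** For p orthogonal to u and e, the lines p /\ (u + t e) form a line of X. Its image places tau(u +
    t e) in the span of tau p and tau u + t k tau e; it remains to remove tau p. *)
Lemma tau_projective u e : om u e != 0 -> exists k, forall t,
  exists b, tau (u + t *: e) = b *: (tau u + (t * k) *: tau e).
Proof.
move=> ue; have [u0 e0] := om_neq0 ue.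
have [z zP] := exists_outside u e m2.
have [a [b []]] := exists_orth z ue; set p := z - _ - _ => up pe.
have p0 : p != 0.
  apply/eqP => p0; apply: (zP a b); apply/eqP.
  by rewrite -subr_eq0 opprD addrA -/p p0.
have pu : om p u = 0 by rewrite omC // up oppr0.
have ep : om e p = 0 by rewrite omC // pe oppr0.
have ute0 t : u + t *: e != 0.
  apply: contraNneq ue => ute; have := om0v A e.
  by rewrite -ute omDl omZl omvv // mulr0 addr0 => ->.
have pute t : om p (u + t *: e) = 0 by rewrite omDr omZr pu pe mulr0 addr0.
have Mi z' : isotropic A (ev 1 (line (wedge p u) (wedge p e)) z').
  rewrite ev_line; case: z' => [t|]; last first.
    apply: isotropic_wedge => //.
    have := @hyperbolic_pencil _ _ A AT A0 p u e 0 1 p0 pu pe ue.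
    by rewrite scale0r add0r scale1r oner_neq0 orbT => ->.
  rewrite -wedgeZr -wedgeDr; apply: isotropic_wedge => //.
  have := @hyperbolic_pencil _ _ A AT A0 p u e 1 t p0 pu pe ue.
  by rewrite scale1r oner_neq0 => ->.
have [w0 [w1 [w01 w1P]]] := line_image f_reg g_reg fK Mi.
have [tp0 tp] := tauP p0; have [tu0 tu] := tauP u0; have [te0 te] := tauP e0.
have tue : om (tau u) (tau e) != 0 by rewrite tau_orthE.
have tpe : om (tau p) (tau e) = 0 by apply/eqP; rewrite tau_orthE // pe.
have tpu : om (tau p) (tau u) = 0 by apply/eqP; rewrite tau_orthE // pu.
have [P0 P0c] := isotropic_coords AT A0 (Mi (Some 0)).
rewrite ev_line in P0c; have w0c := w01 0 P0 P0c; rewrite !scale0r !addr0 in w0c P0c.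
have [P1 P1c] := isotropic_coords AT A0 (Mi None).
rewrite ev_line in P1c; have w1c := w1P P1 P1c.
have wpu : wedge (tau p) (tau u) != 0.
  apply: contraNneq tue => /(wedge_eq0 tp0)[c ->].
  by rewrite omZl tpe mulr0.
have wpe : wedge (tau p) (tau e) != 0.
  apply: contraNneq tue => /(wedge_eq0 tp0)[c ->].
  by rewrite omZr (omC AT) tpu oppr0 mulr0.
have [pP0 uP0] := through_wedge P0c; have [pP1 eP1] := through_wedge P1c.
have [c c0 w0E] := coords_scale (through_two wpu (tp _ pP0) (tu _ uP0)) w0c.
have [d d0 w1E] := coords_scale (through_two wpe (tp _ pP1) (te _ eP1)) w1c.
have [k pk] := om_nondeg A_unit p0.
(* kap is orthogonal to u and e but not to p, so pairing with tau kap detects exactly the tau p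
   component. *)
have [a' [b' []]] := exists_orth k ue; set kap := k - _ - _ => ukap kape.
have kapp : om p kap != 0.
  by rewrite /kap -!scaleNr !omDr !omZr pu pe !mulr0 !addr0.
have [_ kap0] := om_neq0 kapp.
have tkapp : om (tau kap) (tau p) != 0 by rewrite tau_orthE // (omC AT) oppr_eq0.
have tkapu : om (tau kap) (tau u) = 0.
  by apply/eqP; rewrite tau_orthE // (omC AT) ukap oppr0.
have tkape : om (tau kap) (tau e) = 0 by apply/eqP; rewrite tau_orthE // kape.
exists (d / c) => t; set y := tau _.
have tkapy : om (tau kap) y = 0.
  apply/eqP; rewrite tau_orthE //.
  by rewrite omDr omZr kape (omC AT) ukap oppr0 mulr0 addr0.
have [Q Qc] := isotropic_coords AT A0 (Mi (Some t)); rewrite ev_line in Qc.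
have fQc := w01 t Q Qc; rewrite -wedgeZr -wedgeDr in Qc.
have yQ : through y (f Q) by have [_] := tauP (ute0 t); apply; exact: (through_wedge Qc).2.
rewrite w0E w1E scalerA -!wedgeZr -wedgeDr in fQc.
have [al [be yE]] := through_span fQc yQ.
have al0 : al = 0.
  move: tkapy; rewrite yE !omDr !omZr omDr !omZr tkapu tkape !mulr0 addr0 mulr0 addr0.
  by move/eqP; rewrite mulf_eq0 (negPf tkapp) orbF => /eqP.
exists (be * c); rewrite yE al0 scale0r add0r !scalerDr !scalerA.
by congr (_ + _ *: _); field.
Qed.

End Projectivity.
End PointMap.

(** * Linearity of the point map *)

Section FundamentalTheorem.
Variables (F : closedFieldType) (m : nat) (A : 'M[F]_m).
Hypothesis AT : A^T = - A.
Hypothesis A0 : forall i, A i i = 0.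
Hypothesis A_unit : A \in unitmx.
Implicit Types (p q u v w e x y : 'cV[F]_m).
Local Notation om := (om A).

Hypothesis m_gt0 : (0 < m)%N.

Definition dual_vec j : 'cV[F]_m := (row j (invmx A))^T.

Lemma om_dual j v : om (dual_vec j) v = v j 0.
Proof. by rewrite /om trmxK -!row_mul mulVmx // mul1mx mxE. Qed.

(** Nonzero coordinates allow the frame to be rescaled; the second condition makes the line through
    u and each basis vector non-isotropic. *)
Lemma exists_generic_vector :
  exists u, (forall j, u j 0 != 0) /\ forall j, om u (delta_mx j 0) != 0.
Proof.
pose vec (s : 'I_m + 'I_m) : 'cV[F]_m :=
  match s with inl j => delta_mx j 0 | inr j => A *m delta_mx j 0 end.
have vec0 s : vec s != 0.
  have d0 j : delta_mx j 0 != 0 :> 'cV[F]_m.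
    by apply/eqP => /colP/(_ j); rewrite !mxE !eqxx => /eqP; rewrite oner_eq0.
  case: s => j //=; apply: contraNneq (d0 j) => e.
  by rewrite -[delta_mx _ _](mulKmx A_unit) e mulmx0.
have [l lP] := exists_functional (r := enum {: 'I_m + 'I_m}) (fun s _ => vec0 s).
exists l^T; split=> j.
  have := lP (inl j); rewrite mem_enum => /(_ isT) /=.
  by rewrite -colE mx11_eq0 !mxE.
have := lP (inr j); rewrite mem_enum => /(_ isT) /=.
by rewrite mx11_eq0 mulmxA /om trmxK.
Qed.

Variable tau : 'cV[F]_m -> 'cV[F]_m.
Hypothesis tau0 : forall p, p != 0 -> tau p != 0.
Hypothesis tau_om : forall p q, p != 0 -> q != 0 ->
  (om (tau p) (tau q) == 0) = (om p q == 0).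
Hypothesis tau_surj : forall y, y != 0 ->
  exists k c, [/\ k != 0, c != 0 & tau k = c *: y].
Hypothesis tau_proj : forall u e, om u e != 0 -> exists k, forall t,
  exists b, tau (u + t *: e) = b *: (tau u + (t * k) *: tau e).

(* T is fixed by the images of the frame formed by the basis vectors e j and a
   vector u. Projectivity on the hyperbolic lines through u and e j, normalised
   at u - u_j e_j, makes T agree with tau at all u + a e_j. Hence T and tau
   agree on the hyperplanes x_i v_j = x_j v_i, and these cut out x. *)
Lemma collineation_linear : exists2 T, T \in unitmx &
  forall x, x != 0 -> exists c, tau x = c *: (T *m x).
Proof.
have [u [u_neq0 u_om]] := exists_generic_vector.
pose e j : 'cV[F]_m := delta_mx j 0.
have e0 j : e j != 0 by case: (om_neq0 (u_om j)).
have sum_e v : v = \sum_j v j 0 *: e j.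
  by rewrite {1}[v]matrix_sum_delta; apply: eq_bigr => i _; rewrite big_ord1.
pose B := \matrix_(i, j) tau (e j) i 0.
have Be j : B *m e j = tau (e j) by rewrite -colE; apply/colP => i; rewrite !mxE.
have om_sum y v : om y (B *m v) = \sum_j v j 0 * om y (tau (e j)).
  rewrite {1}[v]sum_e mulmx_sumr /om mulmx_sumr summxE; apply: eq_bigr => j _.
  by rewrite -!scalemxAr Be mxE.
(* A row z killing all tau(e j) is om(y, -) with y proportional to some tau k; then k is orthogonal
   to the whole basis, which nondegeneracy forbids. *)
have B_unit : B \in unitmx.
  rewrite -row_free_unit -kermx_eq0; apply/negPn/negP => /rowV0Pn[z].
  rewrite sub_kermx => /eqP zB z0.
  pose y := (z *m invmx A)^T.
  have yA : y^T *m A = z by rewrite trmxK mulmxKV.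
  have y0 : y != 0.
    by apply: contraNneq z0 => y0; rewrite -yA y0 trmx0 mul0mx.
  have [k [c [k0 c0 kE]]] := tau_surj y0.
  suff k_e j : om k (e j) = 0.
    have [w] := om_nondeg A_unit k0; rewrite [w]sum_e /om mulmx_sumr summxE.
    rewrite big1 ?eqxx // => j _; rewrite -scalemxAr mxE.
    by have := k_e j; rewrite /om => ->; rewrite mulr0.
  apply/eqP; rewrite -tau_om // kE omZl -Be /om mulmxA yA zB.
  by rewrite mul0mx mxE mulr0.
have u0 : u != 0 by have [] := om_neq0 (u_om (Ordinal m_gt0)).
pose kd j := dual_vec j.
have e_coord i j : e j i 0 = (i == j)%:R by rewrite mxE eqxx andbT.
have kd_e i j : om (kd i) (e j) = (i == j)%:R by rewrite om_dual e_coord.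
have kd0 j : kd j != 0.
  have [] // := @om_neq0 _ _ A (kd j) (e j).
  by rewrite kd_e eqxx oner_neq0.
pose alpha j := om (tau (kd j)) (tau (e j)).
have alpha0 j : alpha j != 0 by rewrite /alpha tau_om // kd_e eqxx oner_neq0.
have om_kd j v : om (tau (kd j)) (B *m v) = v j 0 * alpha j.
  rewrite om_sum (bigD1 j) //= big1 ?addr0 // => i ij.
  have /eqP -> : om (tau (kd j)) (tau (e i)) == 0.
    by rewrite tau_om // kd_e [j == i]eq_sym (negPf ij).
  by rewrite mulr0.
pose c := invmx B *m tau u.
have Bc : B *m c = tau u by rewrite mulKVmx.
have c0 j : c j 0 != 0.
  have : om (tau (kd j)) (tau u) != 0 by rewrite tau_om // om_dual.
  by rewrite -Bc om_kd mulf_eq0 negb_or => /andP[].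
pose T := B *m diag_mx (\row_j (c j 0 / u j 0)).
have T_unit : T \in unitmx.
  rewrite unitmx_mul B_unit unitmxE det_diag unitfE; apply/prodf_neq0 => j _.
  by rewrite mxE mulf_neq0 ?invr_eq0.
have TE v : T *m v = B *m (\col_j (c j 0 / u j 0 * v j 0)).
  rewrite -mulmxA; congr (_ *m _); apply/colP => j; rewrite mul_diag_mx !mxE //.
have Tu : T *m u = tau u.
  by rewrite TE -Bc; congr (_ *m _); apply/colP => j; rewrite mxE divfK.
have Te j : T *m e j = (c j 0 / u j 0) *: tau (e j).
  rewrite TE -Be scalemxAr; congr (_ *m _); apply/colP => i.
  by rewrite [LHS]mxE [RHS]mxE e_coord; case: eqP => [->|] //; rewrite !mulr0.
have pt0 j a : u + a *: e j != 0.
  apply: contraNneq (u_om j) => ue; have := om0v A (e j).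
  by rewrite -ue omDl omZl omvv // mulr0 addr0 => ->.
have point j a : exists2 b, b != 0 & tau (u + a *: e j) = b *: (T *m (u + a *: e j)).
  have [k kP] := tau_proj (u_om j).
  have b_neq0 t b : tau (u + t *: e j) = b *: (tau u + (t * k) *: tau (e j)) -> b != 0.
    by move=> bE; apply: contraNneq (tau0 (pt0 j t)) => b0; rewrite bE b0 scale0r.
  (* At this parameter the j-th coordinate vanishes, so tau of the point is orthogonal to tau(kd j);
     this determines k. *)
  have [b' b'E] := kP (- u j 0); have b'0 := b_neq0 _ _ b'E.
  have kE : k = c j 0 / u j 0.
    have : om (tau (kd j)) (tau (u + - u j 0 *: e j)) == 0.
      by rewrite tau_om ?pt0 // omDr omZr om_dual kd_e eqxx mulr1 subrr.
    rewrite b'E omZr mulf_eq0 (negPf b'0) /= omDr omZr -Bc om_kd -/(alpha j).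
    rewrite -mulrDl mulf_eq0 (negPf (alpha0 j)) orbF mulNr subr_eq0 => /eqP ->.
    by rewrite mulrAC mulfV ?mul1r.
  have [b bE] := kP a; exists b; first exact: b_neq0 bE.
  by rewrite bE mulmxDr Tu -scalemxAr Te scalerA kE.
exists T => // x x0; pose y := invmx T *m tau x.
have Ty : T *m y = tau x by rewrite mulKVmx.
have prop i j : x i 0 != 0 -> i != j -> x i 0 * y j 0 = x j 0 * y i 0.
  (* kap represents a hyperplane through x, and phi its image hyperplane pulled back by T. That phi
     involves only coordinates i and j and vanishes at y; a known point gives the ratio of its two
     coefficients. *)
  move=> xi ij; pose kap := x j 0 *: kd i - x i 0 *: kd j.
  have om_kap v : om kap v = x j 0 * v i 0 - x i 0 * v j 0.
    by rewrite omDl -scaleNr !omZl !om_dual mulNr.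
  have kap0 : kap != 0.
    have [] // := @om_neq0 _ _ A kap (e j).
    by rewrite om_kap !e_coord (negPf ij) eqxx mulr0 sub0r mulr1 oppr_eq0.
  pose phi v := om (tau kap) (T *m v).
  have phi_e l : l != i -> l != j -> phi (e l) = 0.
    move=> li lj; rewrite /phi Te omZr.
    have /eqP -> : om (tau kap) (tau (e l)) == 0.
      by rewrite tau_om // om_kap !e_coord ![_ == l]eq_sym (negPf li) (negPf lj) !mulr0 subrr.
    by rewrite mulr0.
  have phi_sum v : phi v = v i 0 * phi (e i) + v j 0 * phi (e j).
    have -> : phi v = \sum_l v l 0 * phi (e l).
      rewrite /phi {1}[v]sum_e mulmx_sumr /om mulmx_sumr summxE.
      by apply: eq_bigr => l _; rewrite -!scalemxAr mxE.
    rewrite (bigD1 i) //= (bigD1 j) 1?eq_sym //= big1 ?addr0 // => l /andP[li lj].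
    by rewrite phi_e ?mulr0.
  have phi_pt : x i 0 * phi (e i) + x j 0 * phi (e j) = 0.
    (* Chosen so that coordinates i and j of u + a e_j are in the ratio x_i : x_j. *)
    pose a := x j 0 * u i 0 / x i 0 - u j 0.
    have [b b0 bE] := point j a.
    have ui : (u + a *: e j) i 0 = u i 0.
      by rewrite [LHS]mxE [X in _ + X]mxE e_coord (negPf ij) mulr0 addr0.
    have uj : (u + a *: e j) j 0 = x j 0 * u i 0 / x i 0.
      by rewrite [LHS]mxE [X in _ + X]mxE e_coord eqxx mulr1 addrC subrK.
    have : om (tau kap) (tau (u + a *: e j)) == 0.
      by rewrite tau_om ?pt0 // om_kap ui uj; apply/eqP; field.
    rewrite bE omZr mulf_eq0 (negPf b0) /= -/(phi _) phi_sum ui uj => /eqP h.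
    by apply: (mulfI (u_neq0 i)); rewrite mulr0 -(mulr0 (x i 0)) -h; field.
  have phi_y : y i 0 * phi (e i) + y j 0 * phi (e j) = 0.
    rewrite -phi_sum /phi Ty; apply/eqP; rewrite tau_om // om_kap.
    by rewrite mulrC subrr.
  have phij : phi (e j) != 0.
    apply/eqP => phij; have phii : phi (e i) = 0.
      move/eqP: phi_pt; rewrite phij mulr0 addr0 mulf_eq0 (negPf xi) /=.
      by move/eqP.
    have [w] := om_nondeg A_unit (tau0 kap0).
    have -> : om (tau kap) w = phi (invmx T *m w) by rewrite /phi mulKVmx.
    by rewrite phi_sum phii phij !mulr0 addr0 eqxx.
  apply: (mulIf phij); apply/eqP; rewrite -subr_eq0; apply/eqP.
  have -> : x i 0 * y j 0 * phi (e j) - x j 0 * y i 0 * phi (e j) =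
    x i 0 * (y i 0 * phi (e i) + y j 0 * phi (e j)) -
    y i 0 * (x i 0 * phi (e i) + x j 0 * phi (e j)) by ring.
  by rewrite phi_y phi_pt !mulr0 subrr.
have [i xi] := cV_neq0 x0; exists (y i 0 / x i 0).
rewrite -Ty scalemxAr; congr (_ *m _); apply/colP => j; rewrite [RHS]mxE.
apply: (mulfI xi); have [<-|ij] := eqVneq i j; first by field.
by rewrite prop //; field.
Qed.

Lemma all_eigen_scalar (M : 'M[F]_m) :
  (forall p : 'rV_m, exists c, p *m M = c *: p) -> exists c, M = c%:M.
Proof.
move=> /choice[lam lamE].
pose d i : 'rV[F]_m := delta_mx 0 i.
have dM i k : M i k = lam (d i) * (i == k)%:R.
  have /rowP/(_ k) := lamE (d i); rewrite -rowE mxE => ->.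
  by rewrite !mxE eqxx eq_sym.
pose i0 := Ordinal m_gt0; exists (M i0 i0).
apply/matrixP => i k; rewrite !dM eqxx mulr1 !mxE.
have [_|ik] := eqVneq i k; last by rewrite mulr0.
rewrite mulr1 mulr1n; have [->//|ii0] := eqVneq i i0.
have := lamE (d i + d i0); rewrite mulmxDl -!rowE => /rowP h.
have := h i; have := h i0; rewrite !mxE !dM !eqxx !mulr1 (negPf ii0) eq_sym (negPf ii0) /=.
by rewrite !mulr0 ?addr0 ?add0r !mulr1 => -> ->.
Qed.

(** With M = T^T A T A^-1, the row p^T M vanishes wherever p^T does, hence is a multiple of it; so
    every row vector is an eigenvector of M. *)
Lemma conformal_scalar (T : 'M[F]_m) : T \in unitmx ->
  (forall p q, (om (T *m p) (T *m q) == 0) = (om p q == 0)) ->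
  exists2 c, c != 0 & T^T *m A *m T = c *: A.
Proof.
move=> T_unit T_om; pose M := T^T *m A *m T *m invmx A.
have MA : M *m A = T^T *m A *m T by rewrite mulmxKV.
have M_unit : M \in unitmx by rewrite !unitmx_mul unitmx_tr T_unit A_unit unitmx_inv.
have omT p q : om (T *m p) (T *m q) = (p^T *m M *m A *m q) 0 0.
  by rewrite -(mulmxA _ M) MA /om trmx_mul !mulmxA.
have eig p : exists c, p^T *m M = c *: p^T.
  have [->|p0] := eqVneq p 0; first by exists 0; rewrite trmx0 mul0mx scaler0.
  have [j pj] := cV_neq0 p0; exists ((p^T *m M) 0 j / p j 0).
  apply/rowP => i; rewrite [RHS]mxE [X in _ = _ * X]mxE; apply: (mulfI pj).
  pose r : 'cV[F]_m := p j 0 *: delta_mx i 0 - p i 0 *: delta_mx j 0.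
  have rE (v : 'rV[F]_m) : (v *m r) 0 0 = p j 0 * v 0 i - p i 0 * v 0 j.
    by rewrite mulmxBr -!scalemxAr -!colE !mxE.
  have : om p (invmx A *m r) == 0.
    by rewrite /om mulmxA mulmxK // rE ![p^T _ _]mxE mulrC subrr.
  rewrite -T_om omT mulmxA mulmxK // rE subr_eq0 => /eqP ->.
  by field.
have [|c ME] := all_eigen_scalar (M := M).
  by move=> p; have := eig p^T; rewrite trmxK.
exists c; last by rewrite -MA ME mul_scalar_mx.
apply/eqP => c0; have := mulmxV M_unit; rewrite ME c0 raddf0 mul0mx.
move=> /matrixP/(_ (Ordinal m_gt0) (Ordinal m_gt0)).
by rewrite !mxE eqxx => /eqP; rewrite eq_sym oner_eq0.
Qed.

End FundamentalTheorem.

(** * The action of the symplectic group *)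

Lemma trmxZ (R : pzRingType) n1 n2 (c : R) (M : 'M[R]_(n1, n2)) : (c *: M)^T = c *: M^T.
Proof. by apply/matrixP => i j; rewrite !mxE. Qed.

Section SymplecticAction.
Variables (F : closedFieldType) (m : nat) (A : 'M[F]_m).
Hypothesis AT : A^T = - A.
Hypothesis A0 : forall i, A i i = 0.
Hypothesis A_unit : A \in unitmx.
Hypothesis m2 : (2 < m)%N.
Implicit Types (p q u v w : 'cV[F]_m).

Local Notation X := (grassmannian F m `&` hyperplane A).
Local Notation om := (om A).
Implicit Types (N P Q : X) (S T : Sp A).

Definition acts_by (f : X -> X) (T : 'M[F]_m) := forall Q v w,
  coords (val Q) (wedge v w) -> coords (val (f Q)) (wedge (T *m v) (T *m w)).

Lemma Sp_unit T : val T \in unitmx. Proof. by case/andP: (valP T). Qed.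

Lemma Sp_form T : (val T)^T *m A *m val T = A.
Proof. by case/andP: (valP T) => _ /eqP. Qed.

Lemma om_mul (T : 'M[F]_m) v w : om (T *m v) (T *m w) = (v^T *m (T^T *m A *m T) *m w) 0 0.
Proof. by rewrite /om trmx_mul !mulmxA. Qed.

Lemma om_Sp T v w : om (val T *m v) (val T *m w) = om v w.
Proof. by rewrite om_mul Sp_form. Qed.

Lemma wedge_mul_neq0 (T : 'M[F]_m) v w : T \in unitmx -> wedge v w != 0 ->
  wedge (T *m v) (T *m w) != 0.
Proof.
move=> T_unit vw; have [v0 _] := wedge_neq0 vw.
have Tv0 : T *m v != 0.
  by apply: contraNneq v0 => Tv; rewrite -[v](mulKmx T_unit) Tv mulmx0.
apply: contraNneq vw => /(wedge_eq0 Tv0)[c e].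
by rewrite -[w](mulKmx T_unit) e -scalemxAr mulKmx // wedgeZr wedgevv scaler0.
Qed.

Lemma X_decomp Q : exists v w, coords (val Q) (wedge v w).
Proof.
have [x Qx] := coords_exists (val Q).
have [_ [v [w [xE _]]]] := coords_isotropic AT A0 Qx.
by exists v, w; rewrite -xE.
Qed.

Lemma acts_by_unique f f' (T : 'M[F]_m) : acts_by f T -> acts_by f' T -> f =1 f'.
Proof.
move=> fT f'T Q; have [v [w Qvw]] := X_decomp Q.
by apply: val_inj; apply: coords_inj (fT _ _ _ Qvw) (f'T _ _ _ Qvw).
Qed.

Lemma acts_by_opp f (T : 'M[F]_m) : acts_by f (- T) <-> acts_by f T.
Proof.
have e v w : wedge (- T *m v) (- T *m w) = wedge (T *m v) (T *m w).
  by rewrite !mulNmx -!scaleN1r wedgeZl wedgeZr scalerA mulrNN mulr1 scale1r.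
by split=> fT Q v w Qvw; have := fT Q v w Qvw; rewrite e.
Qed.

Lemma acts_by_comp f f' (T T' : 'M[F]_m) : acts_by f T -> acts_by f' T' ->
  acts_by (f \o f') (T *m T').
Proof. by move=> fT f'T' Q v w Qvw; rewrite -!mulmxA; apply/fT/f'T'. Qed.

Lemma acts_by_id : acts_by id 1%:M.
Proof. by move=> Q v w; rewrite !mul1mx. Qed.

Lemma acts_by_through f T Q u : acts_by f (val T) -> through u Q ->
  through (val T *m u) (f Q).
Proof.
move=> fT /(exists_through AT A0)[v [Qv _]].
exact: (through_wedge (fT _ _ _ Qv)).1.
Qed.

(** The second compound matrix, made of the 2 x 2 minors of T: its action on the exterior square. *)
Definition compound (T : 'M[F]_m) : 'M[F]_(ext2dim m) := \matrix_(k, l)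
  (T (fst_ix k) (fst_ix l) * T (snd_ix k) (snd_ix l) -
   T (snd_ix k) (fst_ix l) * T (fst_ix k) (snd_ix l)).

Lemma compoundE (T : 'M[F]_m) v w :
  compound T *m wedge v w = wedge (T *m v) (T *m w).
Proof.
apply/colP => k; set i := fst_ix k; set j := snd_ix k.
pose B := (row i T)^T *m row j T - (row j T)^T *m row i T.
have BE a b : B a b = T i a * T j b - T j a * T i b.
  by rewrite !mxE !big_ord1 !mxE.
rewrite mxE; under eq_bigr => l _ do rewrite [compound T k l]mxE -BE.
rewrite wedge_formE; first last.
- by move=> a; rewrite BE mulrC subrr.
- by apply/matrixP => a b; rewrite mxE [RHS]mxE !BE opprB [T j b * _]mulrC [T i b * _]mulrC.
have rowE (a b : 'rV[F]_m) :
    (v^T *m (a^T *m b) *m w) 0 0 = (a *m v) 0 0 * (b *m w) 0 0.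
  have -> : v^T *m (a^T *m b) *m w = (a *m v)^T *m (b *m w).
    by rewrite trmx_mul !mulmxA.
  by rewrite [LHS]mxE big_ord1 [X in X * _]mxE.
have entryE (y : 'cV[F]_m) a : (row a T *m y) 0 0 = (T *m y) a 0.
  by rewrite -row_mul mxE.
rewrite mulmxBr mulmxBl [LHS]mxE [X in _ + X]mxE !rowE !entryE [RHS]mxE.
by rewrite -/i -/j.
Qed.

Lemma acts_by_exists T : exists2 f : X -> X, regular f & acts_by f (val T).
Proof.
have /choice[f fP] Q : exists Q', forall x, coords (val Q) x ->
    coords (val Q') (compound (val T) *m x).
  have [v [w Qvw]] := X_decomp Q.
  have [x0 _] := coords_isotropic AT A0 Qvw.
  have [_ [v' [w' [e vw']]]] := coords_isotropic AT A0 Qvw.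
  have [Q' Q'P] : exists Q', coords (val Q') (compound (val T) *m wedge v w).
    apply: (isotropic_coords AT A0); rewrite e in x0 *; rewrite compoundE.
    by apply: isotropic_wedge; rewrite ?om_Sp // wedge_mul_neq0 ?Sp_unit.
  exists Q' => x Qx; have [c c0 ->] := coords_scale Qvw Qx.
  by rewrite -scalemxAr; apply: coordsZ.
exists f; last by move=> Q v w /fP; rewrite compoundE.
move=> P; exists setT, 1%N, (fun k => \sum_l compound (val T) k l *: 'X_l); split=> //.
- exists [set 1] => [_ ->|Q]; first by exists 0%N; exact: dhomog1.
  split=> // _; have [x Qx] := coords_exists Q.
  by exists 1, x; split=> //; rewrite /evalv meval1 oner_neq0.
- by move=> k; apply: rpred_sum => l _; apply: rpredZ; rewrite dhomogX /= mdeg1.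
- move=> Q x _ /fP; congr coords; apply/colP => k; rewrite !mxE /evalv raddf_sum /=.
  by apply: eq_bigr => l _; rewrite mevalZ mevalXU.
Qed.

Lemma aut_of_Sp T : exists f : Aut X, acts_by (val f) (val T).
Proof.
have [f f_reg fT] := acts_by_exists T.
have [g g_reg gT] := acts_by_exists (sp_inv T).
have f_aut : `[< automorphism f >].
  apply/asboolP; split=> //; exists g; split=> // Q.
    apply: (@acts_by_unique (g \o f) id 1%:M) acts_by_id _.
    by rewrite -(mulVmx (Sp_unit T)); apply: acts_by_comp.
  apply: (@acts_by_unique (f \o g) id 1%:M) acts_by_id _.
  by rewrite -(mulmxV (Sp_unit T)); apply: acts_by_comp.
by exists (exist _ f f_aut).
Qed.

Lemma Sp_of_aut (f : Aut X) : exists T, acts_by (val f) (val T).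
Proof.
have /asboolP[f_reg [g [g_reg fK gK]]] := valP f.
have [tau tauP] := induces_exists AT A0 A_unit m2 f_reg g_reg fK gK.
have [sigma sigmaP] := induces_exists AT A0 A_unit m2 g_reg f_reg gK fK.
have tau0 p : p != 0 -> tau p != 0 by move=> /tauP[].
have tau_om := tau_orthE AT A0 A_unit m2 fK gK tauP sigmaP.
have m0 : (0 < m)%N by apply: leq_trans m2.
have [||T T_unit TP] := collineation_linear AT A0 A_unit m0 tau0 tau_om.
- move=> y y0; have [c c0 e] := sigma_tau AT A0 A_unit m2 gK sigmaP tauP y0.
  by exists (sigma y), c; split=> //; case: (sigmaP y y0).
- by move=> u e ue; apply: (tau_projective AT A0 A_unit m2 f_reg g_reg fK gK tauP sigmaP ue).
have {}TP p : p != 0 -> exists2 c, c != 0 & tau p = c *: (T *m p).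
  move=> p0; have [c cE] := TP p p0; exists c => //.
  by apply: contraNneq (tau0 _ p0) => c0; rewrite cE c0 scale0r.
have [|c c0 cE] := conformal_scalar A_unit m0 T_unit.
  move=> p q; have [->|p0] := eqVneq p 0; first by rewrite mulmx0 !om0v.
  have [->|q0] := eqVneq q 0; first by rewrite mulmx0 !omv0.
  rewrite -(tau_om _ _ p0 q0); have [a a0 ->] := TP p p0; have [b b0 ->] := TP q q0.
  by rewrite omZl omZr !mulf_eq0 (negPf a0) (negPf b0).
(* Scaling T by 1/s divides the form by c, which makes T symplectic. *)
have [s sE] : exists s, s ^+ 2 = c.
  have [|s] := closed_rootP ('X^2 - c%:P) _; first by rewrite size_XnsubC.
  by rewrite rootE !hornerE subr_eq0 => /eqP; exists s.
have s0 : s != 0 by apply: contraNneq c0 => s0; rewrite -sE s0 expr0n.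
have TS : (s^-1 *: T \in unitmx) && ((s^-1 *: T)^T *m A *m (s^-1 *: T) == A).
  rewrite unitmxZ ?unitfE ?invr_eq0 // T_unit trmxZ -!scalemxAl -scalemxAr.
  by rewrite cE !scalerA -sE -invfM -expr2 mulVf ?scale1r ?eqxx // sqrf_eq0.
exists (exist _ (s^-1 *: T) TS) => Q v w Qvw /=.
have vw := coords_ne0 Qvw; have [v0 w0] := wedge_neq0 vw.
have [vQ wQ] := through_wedge Qvw.
rewrite -!scalemxAl wedgeZl wedgeZr scalerA.
apply: coordsZ; first by rewrite mulf_neq0 ?invr_eq0.
have Tthrough p : p != 0 -> through p Q -> through (T *m p) (val f Q).
  move=> p0 pQ; have [_ /(_ _ pQ)] := tauP p p0; have [a a0 ->] := TP p p0.
  by move/(throughZ (c := a^-1)); rewrite scalerA mulVf // scale1r; apply; rewrite invr_eq0.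
by apply: through_two; [apply: wedge_mul_neq0|apply: Tthrough|apply: Tthrough].
Qed.

(** T^-1 S fixes every isotropic line, hence every point by [line_through_unique], so it is a scalar
    c; preserving the form gives c^2 = 1. *)
Lemma acts_by_inj f S T : acts_by f (val S) -> acts_by f (val T) ->
  S = T \/ S = sp_opp T.
Proof.
move=> fS fT; pose U := val (sp_mul (sp_inv T) S).
have [c UE] : exists c, U^T = c%:M.
  apply: all_eigen_scalar => [|p]; first exact: leq_trans m2.
  have [p0|p0] := eqVneq p^T 0.
    by exists 0; rewrite -[p]trmxK p0 trmx0 mul0mx scaler0.
  have [c _ e] : exists2 c, c != 0 & U *m p^T = c *: p^T.
    apply: (line_through_unique AT A0 A_unit m2) => // N pN.
    have [g _ gT] := acts_by_exists (sp_inv T).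
    have := acts_by_through gT (acts_by_through fS pN); rewrite mulmxA.
    suff -> : g (f N) = N by [].
    apply: (@acts_by_unique (g \o f) id 1%:M) acts_by_id _.
    by rewrite -(mulVmx (Sp_unit T)); apply: acts_by_comp.
  by exists c; rewrite -[LHS]trmxK trmx_mul trmxK e trmxZ trmxK.
have {}UE : U = c%:M by rewrite -[U]trmxK UE tr_scalar_mx.
have SE : val S = c *: val T.
  by rewrite -[val S](mulKVmx (Sp_unit T)) -[invmx _ *m _]/U UE mul_mx_scalar.
have m0 : (0 < m)%N by apply: leq_trans m2.
have A_neq0 : A != 0.
  apply: contraTneq A_unit => ->; apply/negP => /mulmxV; rewrite mul0mx.
  move=> /matrixP/(_ (Ordinal m0) (Ordinal m0)); rewrite !mxE eqxx => /eqP.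
  by rewrite eq_sym oner_eq0.
have : c ^+ 2 == 1.
  have := Sp_form S; rewrite SE trmxZ -!scalemxAl -scalemxAr Sp_form scalerA.
  rewrite -expr2 => /eqP; rewrite -subr_eq0 -{2}[A]scale1r -scalerBl scaler_eq0.
  by rewrite (negPf A_neq0) orbF subr_eq0.
rewrite sqrf_eq1 => /orP[]/eqP cE; [left|right]; apply: val_inj; rewrite SE cE.
  by rewrite scale1r.
by rewrite scaleN1r.
Qed.

Lemma PSp_Aut : exists phi : PSp A -> Aut X,
  [/\ bijective phi, {morph phi : x y / (x * y)%g >-> (x * y)%g} &
      forall T, acts_by (val (phi (\pi_(PSp A) T))) (val T)].
Proof.
have /choice[aut autP] := aut_of_Sp.
have Aut_eq (f f' : Aut X) (T : 'M_m) : acts_by (val f) T -> acts_by (val f') T -> f = f'.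
  by move=> fT f'T; apply: val_inj; apply: funext; apply: acts_by_unique fT f'T.
pose phi (x : PSp A) := aut (repr x).
have phiP T : acts_by (val (phi (\pi_(PSp A) T))) (val T).
  have /eqP/psp_eqP e := reprK (\pi_(PSp A) T).
  have := autP (repr (\pi_(PSp A) T)); rewrite -/(phi _).
  by case: e => -> //= /acts_by_opp.
exists phi; split=> //.
- have /choice[sp spP] := Sp_of_aut.
  exists (fun f => \pi_(PSp A) (sp f)) => [|f]; last exact: Aut_eq (phiP _) (spP f).
  elim/quotW => T; apply/eqP/psp_eqP.
  exact: acts_by_inj (spP _) (phiP T).
- elim/quotW => S; elim/quotW => T.
  apply: (@Aut_eq _ _ (val S *m val T)).
    have -> : ((\pi_(PSp A) S : PSp A) * (\pi_(PSp A) T))%g = \pi_(PSp A) (S * T)%g.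
      exact: psp_mulE.
    exact: phiP (S * T)%g.
  exact: acts_by_comp (phiP S) (phiP T).
Qed.

(** * Transitivity *)

Definition same_orbit P Q := exists f : Aut X, val f P = Q.

Lemma same_orbit_trans P Q N : same_orbit P Q -> same_orbit Q N -> same_orbit P N.
Proof. by move=> [f <-] [g <-]; exists (g * f)%g. Qed.

Lemma exists_transvection z s : exists T, forall v, val T *m v = v + (s * om z v) *: z.
Proof.
pose T := 1%:M + s *: (z *m (z^T *m A)).
have TE v : T *m v = v + (s * om z v) *: z.
  rewrite mulmxDl mul1mx -scalemxAl -mulmxA -scalerA; congr (_ + _ *: _).
  by rewrite [z^T *m A *m v]mx11_scalar mul_mx_scalar.
have T_om v w : om (T *m v) (T *m w) = om v w.
  by rewrite !TE omDl !omDr !omZl !omZr (omvv AT A0) (omC AT z v); ring.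
have TA : T^T *m A *m T = A.
  apply/matrixP => i j; have := T_om (delta_mx i 0) (delta_mx j 0).
  by rewrite om_mul /om !trmx_delta -!rowE -!colE !mxE.
have T_unit : T \in unitmx.
  by have := A_unit; rewrite -{1}TA unitmx_mul => /andP[].
have TS : (T \in unitmx) && (T^T *m A *m T == A) by rewrite T_unit TA eqxx.
by exists (exist _ T TS).
Qed.

Lemma same_orbit_pencil p q q' P Q : om p q = 0 -> om p q' = 0 -> om q q' != 0 ->
  coords (val P) (wedge p q) -> coords (val Q) (wedge p q') -> same_orbit P Q.
Proof.
move=> pq pq' qq' Pc Qc.
(* This transvection fixes p, which is orthogonal to q - q', and the scalar is the one for which q
   goes to q'. *)
have [T TE] := exists_transvection (q - q') (- (om q q')^-1).
have [f fT] := aut_of_Sp T; exists f; apply: val_inj.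
have := fT _ _ _ Pc; rewrite !TE -!scaleN1r !omDl !omZl (omvv AT A0).
rewrite (omC AT p q) pq (omC AT p q') pq' (omC AT q q').
rewrite oppr0 !mulr0 addr0 mulr0 scale0r addr0 add0r mulN1r opprK mulNr mulVf //.
rewrite scaleN1r scaleN1r opprB addrC subrK => fPc; exact: coords_inj fPc Qc.
Qed.

Lemma same_orbit_through p P Q : through p P -> through p Q -> same_orbit P Q.
Proof.
move=> /(exists_through AT A0)[q [Pc pq]] /(exists_through AT A0)[q' [Qc pq']].
have [z1 [pz1 qz1]] := om_separate A_unit (coords_ne0 Pc).
have [z2 [pz2 qz2]] := om_separate A_unit (coords_ne0 Qc).
(* The orthogonal of p is not the union of two proper subspaces: z1, z2 or their sum works. *)
have [z [pz qz q'z]] : exists z, [/\ om p z = 0, om q z != 0 & om q' z != 0].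
  have [q'z1|q'z1] := eqVneq (om q' z1) 0; last by exists z1.
  have [q'z2|q'z2] := eqVneq (om q z2) 0; last by exists z2.
  by exists (z1 + z2); rewrite !omDr pz1 pz2 q'z1 q'z2 !add0r addr0.
have pzw : wedge p z != 0.
  have [p0 _] := wedge_neq0 (coords_ne0 Pc).
  apply/eqP => /(wedge_eq0 p0)[c zE].
  by rewrite zE omZr (omC AT) pq oppr0 mulr0 eqxx in qz.
have [N Nc] := isotropic_line AT A0 pz pzw.
apply: (same_orbit_trans (same_orbit_pencil pq pz qz Pc Nc)).
by apply: same_orbit_pencil pz pq' _ Nc Qc; rewrite (omC AT) oppr_eq0.
Qed.

(** Q contains a point r orthogonal to a point p of P; the isotropic line joining p and r links P to
    Q unless p and r coincide. *)
Lemma Aut_transitive P Q : same_orbit P Q.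
Proof.
have [p [q Pc]] := X_decomp P; have [p' [q' Qc]] := X_decomp Q.
have [pP _] := through_wedge Pc; have [p'Q q'Q] := through_wedge Qc.
have [r [rQ pr]] : exists r, through r Q /\ om p r = 0.
  have [pp'|pp'] := eqVneq (om p p') 0; first by exists p'.
  pose r := q' - (om p q' / om p p') *: p'.
  exists r; split; last by rewrite /r -scaleNr omDr omZr mulNr divfK // subrr.
  exists (wedge p' q'); split=> //; exists (- p').
  by rewrite -scaleN1r wedgeZr scaleN1r -wedgeC wedgeDr -scaleNr wedgeZr wedgevv scaler0 addr0.
have [p0 _] := wedge_neq0 (coords_ne0 Pc); have r0 := through_neq0 rQ.
have [/(wedge_eq0 p0)[c rE]|prw] := eqVneq (wedge p r) 0.
  apply: (@same_orbit_through r) rQ; rewrite rE; apply: throughZ pP.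
  by apply: contraNneq r0 => c0; rewrite rE c0 scale0r.
have [N Nc] := isotropic_line AT A0 pr prw; have [pN rN] := through_wedge Nc.
exact: same_orbit_trans (same_orbit_through pP pN) (same_orbit_through rN rQ).
Qed.

End SymplecticAction.

Theorem proposition2p1 (R : realType) (n : nat) (A : 'M[R[i]]_(2 * n)) :
  (2 <= n)%N -> A^T = - A -> \rank A = (2 * n)%N ->
  let X := grassmannian R[i] (2 * n) `&` hyperplane A in
  (exists phi : PSp A -> Aut X,
     [/\ bijective phi,
         {morph phi : x y / (x * y)%g >-> (x * y)%g} &
         forall (T : Sp A) (L : X) (v w : 'cV[R[i]]_(2 * n)),
           coords (val L) (wedge v w) ->
           coords (val (val (phi (\pi_(PSp A) T)) L))
                  (wedge (val T *m v) (val T *m w))]) /\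
  (forall P Q : X, exists g : Aut X, val g P = Q).
Proof.
move=> n2 AT A_rank X.
(* Antisymmetric implies alternating in characteristic 0. *)
have A0 i : A i i = 0.
  have /matrixP/(_ i i) := AT; rewrite !mxE => /eqP.
  by rewrite -addr_eq0 -mulr2n Num.Theory.mulrn_eq0 /= => /eqP.
have A_unit : A \in unitmx by rewrite -row_full_unit /row_full A_rank.
have m2 : (2 < 2 * n)%N by apply: (@leq_trans (2 * 2)); rewrite ?leq_mul2l.
by split; [apply: PSp_Aut|apply: Aut_transitive].
Qed.
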